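(* Let $\Omega\subseteq\mathbb{H}$ be a circular domain containing real points (i.e. $\Omega\cap\mathbb{R}\neq\emptyset$), and let $f,g\in\mathcal{SR}(\Omega)$. If $$\exp_*(f+g)=\exp_*(f)*\exp_*(g)$$ then either (i) $f_v$ and $g_v$ are linearly dependent over $\mathcal{SR}_{\mathbb{R}}(\Omega)$, or (ii) there exist $n,m,p\in\mathbb{Z}\setminus\{0\}$ such that $f_v^s\equiv n^2\pi^2$, $g_v^s\equiv m^2\pi^2$, $2\langle f_v,g_v\rangle_*=(p^2-n^2-m^2)\pi^2$ and $n+m\equiv p \pmod 2$. Vice versa, if either (i) or (ii) is satisfied, then $\exp_*(f+g)=\exp_*(f)*\exp_*(g)$.
   Context: $\mathbb{H}$ is the algebra of quaternions (with the Euclidean topology of $\mathbb{R}^4$), with conjugation $q\mapsto q^c$, and $\mathbb{S}=\{q\in\mathbb{H}: q^2=-1\}$. For $D\subseteq\mathbb{C}=\{\alpha+\imath\beta:\alpha,\beta\in\mathbb{R}\}$ invariant under complex conjugation, $\Omega_D=\{\alpha+\beta I:\alpha+\imath\beta\in D,\ I\in\mathbb{S}\}$; sets of this form are called circular, and a circular domain is a connected open circular subset of $\mathbb{H}$. A stem function is $F=F_1+\imath F_2:D\to\mathbb{H}\otimes_{\mathbb{R}}\mathbb{C}$ ($F_1,F_2$ $\mathbb{H}$-valued) with $F(\overline z)=\overline{F(z)}$, where $\overline{p+\imath q}=p-\imath q$. It induces the slice function $f=\mathcal{I}(F):\Omega_D\to\mathbb{H}$, $f(\alpha+\beta I)=F_1(\alpha+\imath\beta)+I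 F_2(\alpha+\imath\beta)$. On a circular domain $\Omega=\Omega_D$, $f=\mathcal I(F)$ is slice-regular if $F$ is holomorphic for the natural complex structures of $\mathbb{C}$ and $\mathbb{H}\otimes_{\mathbb{R}}\mathbb{C}$; $\mathcal{SR}(\Omega)$ is the set of slice-regular functions, and $\mathcal{SR}_{\mathbb{R}}(\Omega)$ is the subset of slice-preserving ones, i.e. those with $F_1,F_2$ real-valued. The $*$-product is $\mathcal I(F)*\mathcal I(G)=\mathcal I(FG)$, with $(p+\imath q)(p'+\imath q')=pp'-qq'+\imath(pq'+qp')$; if one factor is slice-preserving it is the pointwise product. For $f=\mathcal I(F_1+\imath F_2)\in\mathcal{SR}(\Omega)$: $f^c=\mathcal I(F_1^c+\imath F_2^c)$, $f_0=\frac{f+f^c}{2}$, $f_v=\frac{f-f^c}{2}$, $f^s=f*f^c$, and $f_v^s$ means $(f_v)^s$. For $f,g\in\mathcal{SR}(\Omega)$: $\langle f,g\rangle_*=(f*g^c)_0$. Linear dependence of $f_v,g_v$ over $\mathcal{SR}_{\mathbb{R}}(\Omega)$ means that there exist $\alpha,\beta\in\mathcal{SR}_{\mathbb{R}}(\Omega)$, not both identically zero, with $\alpha f_v+\beta g_v\equiv0$. The $*$-exponential is $\exp_*(f)=\sum_{n\in\mathbb{N}}\frac{f^{*n}}{n!}$ ($f^{*n}$ the $n$-th $*$-power, $f^{*0}=1$), which converges uniformly on compact subsets of $\Omega$ to an element of $\mathcal{SR}(\Omega)$. *)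

(* Defs.v *)
From Stdlib Require Export Reals ZArith.
From Stdlib Require Import Lra Psatz ClassicalEpsilon.
From Coquelicot Require Export Coquelicot.

Open Scope R_scope.

(** * Quaternions *)

(** [(a, x, y, z)] is [a + x i + y j + z k].  The topology on [H] is the one
    inferred by Coquelicot for the iterated product, i.e. that of R^4. *)
Definition H : Type := (R * R * R * R)%type.

Definition Hreal (a : R) : H := (a, 0, 0, 0).
Definition Hadd (p q : H) : H :=
  let '(a, x, y, z) := p in
  let '(b, u, v, w) := q in (a + b, x + u, y + v, z + w).
Definition Hopp (p : H) : H :=
  let '(a, x, y, z) := p in (- a, - x, - y, - z).
Definition Hscal (r : R) (p : H) : H :=
  let '(a, x, y, z) := p in (r * a, r * x, r * y, r * z).
Definition Hmul (p q : H) : H :=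
  let '(a, x, y, z) := p in
  let '(b, u, v, w) := q in
  (a * b - x * u - y * v - z * w,
   a * u + x * b + y * w - z * v,
   a * v - x * w + y * b + z * u,
   a * w + x * v - y * u + z * b).
Definition Hconj (p : H) : H :=
  let '(a, x, y, z) := p in (a, - x, - y, - z).

Declare Scope quat_scope.
Delimit Scope quat_scope with H.
Bind Scope quat_scope with H.
Infix "+" := Hadd : quat_scope.
Notation "- p" := (Hopp p) : quat_scope.
Notation "p - q" := (Hadd p (Hopp q)) : quat_scope.
Infix "*" := Hmul : quat_scope.

Definition imag_unit (q : H) : Prop := (q * q)%H = Hreal (-1).

(** * The algebra H (x) C *)

(** [(c0, c1, c2, c3)] is [c0 + i c1 + j c2 + k c3] with coefficients in C:
    this is H (x) C with its natural structure of complex vector space.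
    [HCmk p q] is the element p + iota q with p, q in H. *)
Definition HC : Type := (C * C * C * C)%type.

Definition HCmk (p q : H) : HC :=
  let '(a, x, y, z) := p in
  let '(b, u, v, w) := q in
  ((a, b), (x, u), (y, v), (z, w)).
Definition HCre (w : HC) : H :=
  let '(c0, c1, c2, c3) := w in (Re c0, Re c1, Re c2, Re c3).
Definition HCim (w : HC) : H :=
  let '(c0, c1, c2, c3) := w in (Im c0, Im c1, Im c2, Im c3).
Definition HCbar (w : HC) : HC := HCmk (HCre w) (- HCim w)%H.
Definition HCmul (v w : HC) : HC :=
  HCmk (HCre v * HCre w - HCim v * HCim w)%H
       (HCre v * HCim w + HCim v * HCre w)%H.
Definition HCconj (w : HC) : HC := HCmk (Hconj (HCre w)) (Hconj (HCim w)).

(** * Circular domains *)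

Definition conj_invariant (D : C -> Prop) : Prop :=
  forall z, D z -> D (Cconj z).

Definition Omega (D : C -> Prop) (q : H) : Prop :=
  exists (a b : R) (J : H),
    D (a, b) /\ imag_unit J /\ q = (Hreal a + Hscal b J)%H.

Definition connected_set {T : UniformSpace} (A : T -> Prop) : Prop :=
  forall U V : T -> Prop, open U -> open V ->
    (forall x, A x -> U x \/ V x) ->
    (exists x, A x /\ U x) -> (exists x, A x /\ V x) ->
    exists x, A x /\ U x /\ V x.

(** [Omega D] is a circular domain. *)
Definition circular_domain (D : C -> Prop) : Prop :=
  conj_invariant D /\ open (Omega D) /\ connected_set (Omega D).

(** * Slice functions *)

(** Functions are total; only their values on [D], resp. on [Omega D],
    matter. *)
Definition stem_function (D : C -> Prop) (F : C -> HC) : Prop :=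
  forall z, D z -> F (Cconj z) = HCbar (F z).

Definition induces (D : C -> Prop) (F : C -> HC) (f : H -> H) : Prop :=
  forall (a b : R) (J : H), D (a, b) -> imag_unit J ->
    f (Hreal a + Hscal b J)%H = (HCre (F (a, b)) + J * HCim (F (a, b)))%H.

(** The slice function I(F), computed at q = a + v with b = |v|, J = v / |v|.
    When v = 0 the second summand vanishes, since then [Hscal (/ b) _] is 0;
    for a stem function this is the right value, since F_2 = 0 on the real
    axis (see [slice_fun_induced]). *)
Definition slice_fun (F : C -> HC) (q : H) : H :=
  let '(a, x, y, z) := q in
  let b := sqrt (x * x + y * y + z * z) in
  (HCre (F (a, b)) + Hscal (/ b) (0, x, y, z) * HCim (F (a, b)))%H.

Definition slice (D : C -> Prop) (f : H -> H) : Prop :=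
  exists F, stem_function D F /\ induces D F f.

(** The stem function inducing a slice function; its values on [D] are
    determined by those of [f] on [Omega D] (see [stem_unique]). *)
Definition stem (D : C -> Prop) (f : H -> H) : C -> HC :=
  epsilon (inhabits (fun _ => HCmk (Hreal 0) (Hreal 0)))
    (fun F => stem_function D F /\ induces D F f).

Definition holomorphic (D : C -> Prop) (F : C -> HC) : Prop :=
  forall z, D z -> ex_derive (K := C_AbsRing) F z.

(** The set SR(Omega D). *)
Definition slice_regular (D : C -> Prop) (f : H -> H) : Prop :=
  exists F, stem_function D F /\ induces D F f /\ holomorphic D F.

(** The set SR_R(Omega D). *)
Definition slice_regular_preserving (D : C -> Prop) (f : H -> H) : Prop :=
  exists F, stem_function D F /\ induces D F f /\ holomorphic D F /\
    forall z, D z ->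
      exists r s : R, HCre (F z) = Hreal r /\ HCim (F z) = Hreal s.

(** * Operations on slice functions *)

Definition sadd (f g : H -> H) (q : H) : H := (f q + g q)%H.

Definition smul (D : C -> Prop) (f g : H -> H) : H -> H :=
  slice_fun (fun z => HCmul (stem D f z) (stem D g z)).

Definition sconj (D : C -> Prop) (f : H -> H) : H -> H :=
  slice_fun (fun z => HCconj (stem D f z)).

Definition spart0 (D : C -> Prop) (f : H -> H) (q : H) : H :=
  Hscal (/ 2) (f q + sconj D f q)%H.

Definition spartv (D : C -> Prop) (f : H -> H) (q : H) : H :=
  Hscal (/ 2) (f q - sconj D f q)%H.

(** The symmetrization f^s. *)
Definition ssym (D : C -> Prop) (f : H -> H) : H -> H := smul D f (sconj D f).

(** The product <f, g>_*. *)
Definition sinner (D : C -> Prop) (f g : H -> H) : H -> H :=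
  spart0 D (smul D f (sconj D g)).

Fixpoint spow (D : C -> Prop) (f : H -> H) (n : nat) : H -> H :=
  match n with
  | O => fun _ => Hreal 1
  | S m => smul D f (spow D f m)
  end.

(** The sum in H, taken coordinatewise, of the series of f^{*n}(q) / n!. *)
Definition sexp (D : C -> Prop) (f : H -> H) (q : H) : H :=
  let t n := Hscal (/ INR (fact n)) (spow D f n q) in
  (Series (fun n => let '(a, x, y, z) := t n in a),
   Series (fun n => let '(a, x, y, z) := t n in x),
   Series (fun n => let '(a, x, y, z) := t n in y),
   Series (fun n => let '(a, x, y, z) := t n in z)).

Definition linearly_dependent (D : C -> Prop) (f g : H -> H) : Prop :=
  exists alpha beta : H -> H,
    slice_regular_preserving D alpha /\ slice_regular_preserving D beta /\
    ~ (forall q, Omega D q -> alpha q = Hreal 0 /\ beta q = Hreal 0) /\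
    forall q, Omega D q -> (alpha q * f q + beta q * g q)%H = Hreal 0.

(** * Well-definedness of the operations *)

Ltac Hunfold := unfold Hadd, Hopp, Hscal, Hreal, Hmul, Hconj, HCbar, HCmk,
  HCre, HCim, Re, Im in *; cbn [fst snd] in *.

Lemma H_ext (a b x u y v z w : R) :
  a = b -> x = u -> y = v -> z = w -> (a, x, y, z) = (b, u, v, w).
Proof. now intros -> -> -> ->. Qed.

Lemma imag_unit_inv (J : H) : imag_unit J ->
  exists x y z, J = (0, x, y, z) /\ x * x + y * y + z * z = 1.
Proof.
destruct J as [[[a x] y] z]; unfold imag_unit; Hunfold.
intros E; injection E as E0 E1 E2 E3.
assert (a = 0) by nra; subst a.
exists x, y, z; split; [reflexivity | lra].
Qed.

Lemma imag_unit_i : imag_unit (0, 1, 0, 0).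
Proof. unfold imag_unit; Hunfold; apply H_ext; ring. Qed.

Lemma HC_ext (v w : HC) : HCre v = HCre w -> HCim v = HCim w -> v = w.
Proof.
destruct v as [[[[? ?] [? ?]] [? ?]] [? ?]].
destruct w as [[[[? ?] [? ?]] [? ?]] [? ?]].
Hunfold; intros E1 E2; injection E1; injection E2; intros; subst; reflexivity.
Qed.

Lemma HCre_mk (p q : H) : HCre (HCmk p q) = p.
Proof.
now destruct p as [[[? ?] ?] ?]; destruct q as [[[? ?] ?] ?].
Qed.

Lemma HCim_mk (p q : H) : HCim (HCmk p q) = q.
Proof.
now destruct p as [[[? ?] ?] ?]; destruct q as [[[? ?] ?] ?].
Qed.

Lemma stem_unique (D : C -> Prop) (F G : C -> HC) (f : H -> H) :
  conj_invariant D -> stem_function D F -> stem_function D G ->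
  induces D F f -> induces D G f -> forall z, D z -> F z = G z.
Proof.
intros HD sF sG iF iG [a b] Dz.
pose proof (iF a b _ Dz imag_unit_i) as E1.
rewrite (iG a b _ Dz imag_unit_i) in E1.
pose proof (HD _ Dz) as Dz'; change (D (a, - b)) in Dz'.
pose proof (iF a (- b) _ Dz' imag_unit_i) as E2.
rewrite (iG a (- b) _ Dz' imag_unit_i) in E2.
change (a, - b) with (Cconj (a, b)) in E2.
rewrite (sF _ Dz), (sG _ Dz) in E2.
unfold HCbar in E2; rewrite !HCre_mk, !HCim_mk in E2.
apply HC_ext; revert E1 E2;
destruct (HCre (F (a, b))) as [[[? ?] ?] ?];
destruct (HCim (F (a, b))) as [[[? ?] ?] ?];
destruct (HCre (G (a, b))) as [[[? ?] ?] ?];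
destruct (HCim (G (a, b))) as [[[? ?] ?] ?];
Hunfold; intros E1 E2; injection E1 as ? ? ? ?; injection E2 as ? ? ? ?;
apply H_ext; lra.
Qed.

Lemma slice_fun_induced (D : C -> Prop) (F : C -> HC) :
  conj_invariant D -> stem_function D F -> induces D F (slice_fun F).
Proof.
intros HD sF a b J Dz HJ.
destruct (imag_unit_inv J HJ) as (x & y & z & -> & N).
assert (Eq : (Hreal a + Hscal b (0, x, y, z))%H = (a, b * x, b * y, b * z)).
{ Hunfold; apply H_ext; ring. }
rewrite Eq; unfold slice_fun.
replace (b * x * (b * x) + b * y * (b * y) + b * z * (b * z))
  with (Rsqr b) by (unfold Rsqr; transitivity (b * b * (x * x + y * y + z * z));
                    [rewrite N |]; ring).
rewrite sqrt_Rsqr_abs.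
destruct (Rtotal_order b 0) as [Hb | [Hb | Hb]].
- rewrite Rabs_left by assumption.
  change (a, - b) with (Cconj (a, b)); rewrite (sF _ Dz).
  unfold HCbar; rewrite HCre_mk, HCim_mk; f_equal.
  destruct (HCim (F (a, b))) as [[[? ?] ?] ?]; Hunfold.
  apply H_ext; field; lra.
- subst b; rewrite Rabs_R0; f_equal.
  pose proof (sF _ Dz) as E; unfold Cconj in E; cbn [fst snd] in E.
  rewrite Ropp_0 in E.
  assert (E' := f_equal HCim E); revert E'; unfold HCbar; rewrite HCim_mk.
  destruct (HCim (F (a, 0))) as [[[? ?] ?] ?]; Hunfold.
  intros E'; injection E' as ? ? ? ?.
  apply H_ext; nra.
- rewrite Rabs_right by lra; f_equal.
  destruct (HCim (F (a, b))) as [[[? ?] ?] ?]; Hunfold.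
  apply H_ext; field; lra.
Qed.

Lemma stem_spec (D : C -> Prop) (f : H -> H) : slice D f ->
  stem_function D (stem D f) /\ induces D (stem D f) f.
Proof.
exact (epsilon_spec _ (fun F => stem_function D F /\ induces D F f)).
Qed.

Lemma stem_induced (D : C -> Prop) (F : C -> HC) (f : H -> H) :
  conj_invariant D -> stem_function D F -> induces D F f ->
  forall z, D z -> stem D f z = F z.
Proof.
intros HD sF iF.
destruct (stem_spec D f (ex_intro _ F (conj sF iF))) as [s i].
now apply (stem_unique D (stem D f) F f).
Qed.

(* Main.v *)
Require Import Defs.
From Stdlib Require Import Lra Psatz ClassicalEpsilon Lia Bool.

(** Write the stem functions of f and g as F = F0 + A and G = G0 + B, with F0, G0
    complex-valued and A, B vectors of C^3; they are holomorphic maps on the plane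
    domain D.  All the operations of the theorem are computed pointwise on stems, so
    the equation says that exp (F + G) = exp F exp G in the complex quaternions
    at every point of D.  The scalars F0, G0 are central and their exponentials
    invertible, hence it is equivalent to exp (A + B) = exp A exp B
    ([HCexp_vec], [exp_equation_stem]).  If A^2 = - r^2 then
    exp A = cos r + (sin r / r) A ([HCexp_trig]).

    Suppose the equation holds.  If the cross product A x B vanishes on D, the minors
    A_i B_j = A_j B_i give a linear relation with holomorphic coefficients - B_i
    and A_i ([dependent_of_parallel]).  Otherwise, by the identity theorem, A x B is
    nonzero at some real point.  On the real axis A and B are real vectors; where
    A x B <> 0 the vectors A, B, A x B are linearly independent over R, and comparing
    coordinates in the equation forces the sines of |A|, |B|, |A + B| to vanish
    ([noncommuting_exp]).  These lengths are thus multiples of pi; being continuous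
    they are constant near that point, and the identity theorem spreads the equations
    A.A = n^2 pi^2, B.B = m^2 pi^2, (A + B).(A + B) = p^2 pi^2 to D ([quantize]).  The
    scalar part cos (p pi) = cos (n pi) cos (m pi) is the parity condition.  This is where
    the real points matter: over C, a nonzero A x B may be isotropic and lie in
    the span of A and B.

    Conversely, a relation alpha A + beta B = 0 gives alpha (A x B) = beta (A x B) = 0.
    Holomorphic functions on D have no zero divisors, so A x B = 0, which means that A
    and B commute, and exp is multiplicative on commuting elements ([HCexp_add]).  In
    case (ii) the three exponentials are the scalars cos (n pi), cos (m pi), cos (p pi).

    Holomorphy only means complex differentiability, so the identity theorem is built
    from Goursat's lemma ([goursat]).  It yields Cauchy's formula on a square
    ([cauchy_formula]) in the form f(z) k(z) = I(z), where I integrates f(w) / (w - z) and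
    k(z), the integral of 1 / (w - z), only has to be known nonzero.  Expanding
    1 / (w - z) around the centre of the square shows that a function vanishing on a
    segment through the centre vanishes near it ([local_uniqueness]).  The
    global statement ([identity_theorem]) follows by connectedness, which is given
    for the domain of H and is transported to D through conjugation-invariant sets. *)

(** * Complex differentiability *)

(** The source and the target carry the topology of the modulus, which is the one
    used by complex derivatives. *)
Definition ccont (f : C -> C) (z : C) : Prop :=
  @continuous (AbsRing_UniformSpace C_AbsRing) (AbsRing_UniformSpace C_AbsRing) f z.

(** Caratheodory's form of differentiability: the slope extends continuously.
    Sums, products and difference quotients then reduce to continuity. *)
Definition cdiff (f : C -> C) (z : C) : Prop :=
  exists phi : C -> C, ccont phi z /\
    forall w, (f w = f z + phi w * (w - z))%C.

Lemma ccontE f z : ccont f z <->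
  forall eps, 0 < eps -> exists del, 0 < del /\
    forall w, Cmod (w - z) < del -> Cmod (f w - f z) < eps.
Proof.
split.
- intros Hc eps He.
  destruct (Hc (fun w => Cmod (w - f z) < eps)) as [d Hd].
  { now exists (mkposreal eps He). }
  exists d; split; [apply cond_pos | exact Hd].
- intros Hc P [e He].
  destruct (Hc e (cond_pos e)) as (d & d0 & Hd).
  exists (mkposreal d d0); intros w Hw; apply He, Hd, Hw.
Qed.

Lemma ccont_const c z : ccont (fun _ => c) z.
Proof. exact (@continuous_const (AbsRing_UniformSpace C_AbsRing) (AbsRing_UniformSpace C_AbsRing) c z). Qed.

Lemma ccont_id z : ccont (fun w => w) z.
Proof. exact (@continuous_id (AbsRing_UniformSpace C_AbsRing) z). Qed.

Lemma ccont_plus f g z :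
  ccont f z -> ccont g z -> ccont (fun w => f w + g w)%C z.
Proof.
exact (@continuous_plus (AbsRing_UniformSpace C_AbsRing) C_AbsRing
         (AbsRing_NormedModule C_AbsRing) f g z).
Qed.

Lemma ccont_mult f g z :
  ccont f z -> ccont g z -> ccont (fun w => f w * g w)%C z.
Proof.
exact (@continuous_mult (AbsRing_UniformSpace C_AbsRing) C_AbsRing f g z).
Qed.

Lemma ccont_ext f g z : (forall w, f w = g w) -> ccont f z -> ccont g z.
Proof. exact (@continuous_ext (AbsRing_UniformSpace C_AbsRing)
  (AbsRing_UniformSpace C_AbsRing) f g z). Qed.

Lemma ccont_minus f g z :
  ccont f z -> ccont g z -> ccont (fun w => f w - g w)%C z.
Proof.
intros Hf Hg.
apply (ccont_ext (fun w => f w + (- RtoC 1) * g w)%C).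
{ intros w; ring. }
apply ccont_plus; [exact Hf |].
apply ccont_mult; [apply ccont_const | exact Hg].
Qed.

Lemma Cmod_minus_sym (z w : C) : Cmod (z - w) = Cmod (w - z).
Proof. rewrite <- Cmod_opp; f_equal; ring. Qed.

Lemma Cmod_tri_inv (z w : C) : Cmod z - Cmod w <= Cmod (z - w).
Proof.
pose proof (Cmod_triangle (z - w)%C w) as T.
replace (z - w + w)%C with z in T by ring; lra.
Qed.

Lemma Cminus_neq (z w : C) : z <> w -> (z - w)%C <> 0.
Proof. intros N E; apply N; replace z with (z - w + w)%C by ring; rewrite E; ring. Qed.

Lemma ccont_inv (z : C) : z <> 0 -> ccont Cinv z.
Proof.
intros Hz; apply ccontE; intros eps He.
assert (m0 : 0 < Cmod z) by apply Cmod_gt_0, Hz.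
exists (Rmin (Cmod z / 2) (eps * Cmod z * Cmod z / 2)); split.
{ apply Rmin_case; [lra |].
  apply Rdiv_lt_0_compat; [| lra].
  repeat apply Rmult_lt_0_compat; lra. }
intros w Hw.
assert (H1 := Rlt_le_trans _ _ _ Hw (Rmin_l _ _)).
assert (H2 := Rlt_le_trans _ _ _ Hw (Rmin_r _ _)).
assert (mw : Cmod z / 2 < Cmod w).
{ pose proof (Cmod_tri_inv z w); rewrite Cmod_minus_sym in H; lra. }
assert (Hw0 : w <> 0) by (apply Cmod_gt_0; lra).
replace (/ w - / z)%C with (- (w - z) / (w * z))%C by (field; split; assumption).
rewrite Cmod_div by now apply Cmult_neq_0.
rewrite Cmod_opp, Cmod_mult.
assert (P : 0 < Cmod w * Cmod z) by nra.
apply (Rmult_lt_reg_r _ _ _ P).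
unfold Rdiv; rewrite Rmult_assoc, Rinv_l, Rmult_1_r by lra.
assert (0 < eps * Cmod z * (Cmod w - Cmod z / 2))
  by (repeat apply Rmult_lt_0_compat; lra).
lra.
Qed.

Lemma ccont_inv_shift c z : z <> c -> ccont (fun w => / (w - c))%C z.
Proof.
intros Hz.
apply (@continuous_comp (AbsRing_UniformSpace C_AbsRing)
  (AbsRing_UniformSpace C_AbsRing) (AbsRing_UniformSpace C_AbsRing)
  (fun w => w - c)%C Cinv z).
- apply ccont_minus; [apply ccont_id | apply ccont_const].
- apply ccont_inv; now apply Cminus_neq.
Qed.

Lemma cdiff_cont f z : cdiff f z -> ccont f z.
Proof.
intros (phi & c & E).
apply (ccont_ext (fun w => f z + phi w * (w - z))%C); [easy |].
apply ccont_plus; [apply ccont_const | apply ccont_mult; [exact c |]].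
apply ccont_minus; [apply ccont_id | apply ccont_const].
Qed.

Lemma cdiff_ext f g z : (forall w, f w = g w) -> cdiff f z -> cdiff g z.
Proof. intros E (phi & c & F); exists phi; split; [exact c |]; intros w; now rewrite <- !E. Qed.

Lemma cdiff_const c z : cdiff (fun _ => c) z.
Proof. exists (fun _ => RtoC 0); split; [apply ccont_const | intros; ring]. Qed.

Lemma cdiff_plus f g z : cdiff f z -> cdiff g z -> cdiff (fun w => f w + g w)%C z.
Proof.
intros (p & cp & Ep) (q & cq & Eq).
exists (fun w => p w + q w)%C; split; [now apply ccont_plus |].
intros w; rewrite Ep, Eq; ring.
Qed.

Lemma cdiff_mult f g z : cdiff f z -> cdiff g z -> cdiff (fun w => f w * g w)%C z.
Proof.
intros Hf Hg; pose proof (cdiff_cont _ _ Hg) as Cg.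
destruct Hf as (p & cp & Ep); destruct Hg as (q & cq & Eq).
exists (fun w => p w * g w + f z * q w)%C; split.
- apply ccont_plus; apply ccont_mult; try assumption; apply ccont_const.
- intros w; rewrite (Ep w), (Eq w); ring.
Qed.

Lemma cdiff_minus f g z : cdiff f z -> cdiff g z -> cdiff (fun w => f w - g w)%C z.
Proof.
intros Hf Hg.
apply (cdiff_ext (fun w => f w + (- RtoC 1) * g w)%C).
{ intros w; ring. }
apply cdiff_plus; [exact Hf |].
apply cdiff_mult; [apply cdiff_const | exact Hg].
Qed.

Definition dquot (f : C -> C) (c l : C) (w : C) : C :=
  if excluded_middle_informative (w = c) then l else ((f w - f c) / (w - c))%C.

Lemma dquot_neq f c l w : w <> c -> dquot f c l w = ((f w - f c) / (w - c))%C.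
Proof. intros N; unfold dquot; now destruct excluded_middle_informative. Qed.

Lemma dquot_cont_center f c : cdiff f c -> exists l, ccont (dquot f c l) c.
Proof.
intros (phi & cp & E); exists (phi c).
apply (ccont_ext phi); [| exact cp].
intros w; unfold dquot; destruct excluded_middle_informative as [-> | N]; [easy |].
rewrite E; field; now apply Cminus_neq.
Qed.

Lemma dquot_cdiff f c l z : z <> c -> cdiff f z -> cdiff (dquot f c l) z.
Proof.
intros N Hf; pose proof (cdiff_cont _ _ Hf) as Cf; destruct Hf as (p & cp & Ep).
set (psi := fun w => (p w * (z - c) - (f z - f c))%C).
assert (Nz := Cminus_neq _ _ N).
(* The slope between w and z is psi w / ((w - c) (z - c)), except at w = c, which is
   away from z. *)
exists (fun w => if excluded_middle_informative (w = c)
  then ((l - dquot f c l z) / (w - z))%C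
  else (psi w * / ((w - c)) * / (z - c))%C); split.
- assert (Q : ccont (fun w => psi w * / ((w - c)) * / (z - c))%C z).
  { apply ccont_mult; [apply ccont_mult | apply ccont_const].
    - apply ccont_minus; [apply ccont_mult; [exact cp |] |]; apply ccont_const.
    - now apply ccont_inv_shift. }
  rewrite ccontE in Q |- *; intros eps He.
  destruct (Q eps He) as (d & d0 & Hd).
  exists (Rmin d (Cmod (z - c))); split.
  { apply Rmin_case; [easy | now apply Cmod_gt_0]. }
  intros w Hw.
  destruct (excluded_middle_informative (w = c)) as [-> |];
  destruct (excluded_middle_informative (z = c)) as [|]; try easy.
  + pose proof (Rlt_le_trans _ _ _ Hw (Rmin_r _ _)) as A.
    rewrite Cmod_minus_sym in A; lra.
  + apply Hd, (Rlt_le_trans _ _ _ Hw), Rmin_l.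
- intros w; destruct excluded_middle_informative as [E | Nw].
  + rewrite E at 1; unfold dquot at 1.
    destruct excluded_middle_informative as [_ |]; [| easy].
    rewrite E; field. apply Cminus_neq; now apply not_eq_sym.
  + rewrite !dquot_neq by assumption; unfold psi; rewrite (Ep w).
    field; split; [assumption | now apply Cminus_neq].
Qed.

(** * Integrals along the boundary of a rectangle *)

Definition cint (g : R -> C) (a b : R) : C :=
  (RInt (fun t => Re (g t)) a b, RInt (fun t => Im (g t)) a b).

Definition pcont (g : R -> C) (a b : R) : Prop := forall t, a <= t <= b ->
  continuous (fun t => Re (g t)) t /\ continuous (fun t => Im (g t)) t.

Lemma pcont_int g a b : a <= b -> pcont g a b ->
  ex_RInt (fun t => Re (g t)) a b /\ ex_RInt (fun t => Im (g t)) a b.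
Proof.
intros ab G; split; apply (ex_RInt_continuous (V := R_CompleteNormedModule));
  intros z; rewrite Rmin_left, Rmax_right by exact ab; intros Hz; apply G, Hz.
Qed.

Lemma cint_ext f g a b : a <= b -> (forall t, a <= t <= b -> f t = g t) ->
  cint f a b = cint g a b.
Proof.
intros ab E; unfold cint; f_equal; apply RInt_ext; intros t;
  rewrite Rmin_left, Rmax_right by exact ab; intros Ht; rewrite E; lra || easy.
Qed.

Lemma cint_plus f g a b : a <= b -> pcont f a b -> pcont g a b ->
  cint (fun t => f t + g t)%C a b = (cint f a b + cint g a b)%C.
Proof.
intros ab F G.
destruct (pcont_int _ _ _ ab F), (pcont_int _ _ _ ab G).
unfold cint, Cplus; cbn [fst snd]; f_equal;
  [rewrite <- (RInt_plus (V := R_CompleteNormedModule) (fun t => Re (f t)))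
  |rewrite <- (RInt_plus (V := R_CompleteNormedModule) (fun t => Im (f t)))];
  easy.
Qed.

Lemma cint_scal c f a b : a <= b -> pcont f a b ->
  cint (fun t => c * f t)%C a b = (c * cint f a b)%C.
Proof.
intros ab F.
destruct (pcont_int _ _ _ ab F) as [F1 F2].
assert (E : forall k, ex_RInt (fun t => k * Re (f t)) a b /\
  ex_RInt (fun t => k * Im (f t)) a b).
{ intros k; split; now apply (ex_RInt_scal (V := R_CompleteNormedModule)). }
assert (S1 : forall k, RInt (fun t => k * Re (f t)) a b
  = k * RInt (fun t => Re (f t)) a b).
{ intros k; now apply (RInt_scal (V := R_CompleteNormedModule)). }
assert (S2 : forall k, RInt (fun t => k * Im (f t)) a b
  = k * RInt (fun t => Im (f t)) a b).
{ intros k; now apply (RInt_scal (V := R_CompleteNormedModule)). }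
unfold cint, Cmult; cbn [fst snd]; f_equal; rewrite <- S1, <- S2.
- refine (eq_trans _ (RInt_minus (V := R_CompleteNormedModule)
    (fun t => Re c * Re (f t)) (fun t => Im c * Im (f t)) a b
    (proj1 (E _)) (proj2 (E _)))); now apply RInt_ext.
- refine (eq_trans _ (RInt_plus (V := R_CompleteNormedModule)
    (fun t => Re c * Im (f t)) (fun t => Im c * Re (f t)) a b
    (proj2 (E _)) (proj1 (E _)))); now apply RInt_ext.
Qed.

Lemma cint_chasles f a b c : a <= b <= c -> pcont f a c ->
  (cint f a b + cint f b c)%C = cint f a c.
Proof.
intros abc F.
destruct (pcont_int f a b) as [A1 A2]; [easy | intros t Ht; apply F; lra |].
destruct (pcont_int f b c) as [B1 B2]; [easy | intros t Ht; apply F; lra |].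
exact (f_equal2 pair (RInt_Chasles (V := R_CompleteNormedModule) _ a b c A1 B1)
  (RInt_Chasles (V := R_CompleteNormedModule) _ a b c A2 B2)).
Qed.

Lemma Cmod_le_sum (z : C) : Cmod z <= Rabs (Re z) + Rabs (Im z).
Proof.
destruct z as [x y].
replace (x, y) with (RtoC x + Ci * RtoC y)%C
  by (unfold RtoC, Ci, Cplus, Cmult; cbn; f_equal; ring).
eapply Rle_trans; [apply Cmod_triangle |].
rewrite Cmod_mult, !Cmod_R.
replace (Cmod Ci) with 1.
- unfold Re, Im, RtoC, Ci, Cplus, Cmult; cbn.
  replace (x + (0 * y - 1 * 0)) with x by ring.
  replace (0 + (0 * 0 + 1 * y)) with y by ring; lra.
- unfold Cmod, Ci; cbn; rewrite <- sqrt_1 at 1; f_equal; ring.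
Qed.

Lemma Re_le_Cmod (z : C) : Rabs (Re z) <= Cmod z.
Proof. eapply Rle_trans; [apply Rmax_l | apply Rmax_Cmod]. Qed.
Lemma Im_le_Cmod (z : C) : Rabs (Im z) <= Cmod z.
Proof. eapply Rle_trans; [apply Rmax_r | apply Rmax_Cmod]. Qed.

Lemma cint_bound f a b M : a <= b -> pcont f a b ->
  (forall t, a <= t <= b -> Cmod (f t) <= M) ->
  Cmod (cint f a b) <= 2 * M * (b - a).
Proof.
intros ab F B.
destruct (pcont_int f a b ab F) as [A1 A2].
eapply Rle_trans; [apply Cmod_le_sum |]; unfold cint; cbn [Re Im fst snd].
assert (Rabs (RInt (fun t => Re (f t)) a b) <= (b - a) * M).
{ apply abs_RInt_le_const; try easy; intros t Ht.
  eapply Rle_trans; [apply Re_le_Cmod | now apply B]. }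
assert (Rabs (RInt (fun t => Im (f t)) a b) <= (b - a) * M).
{ apply abs_RInt_le_const; try easy; intros t Ht.
  eapply Rle_trans; [apply Im_le_Cmod | now apply B]. }
unfold Re, Im in *; cbn [fst snd] in *; lra.
Qed.

Lemma cint_affine (p q : C) a b :
  cint (fun t => p + q * RtoC t)%C a b
  = (p * RtoC (b - a) + q * RtoC ((b * b - a * a) / 2))%C.
Proof.
assert (Q : forall p q, RInt (fun t => p + q * t) a b
  = p * (b - a) + q * ((b * b - a * a) / 2)).
{ clear p q; intros p q; apply is_RInt_unique.
  replace (p * (b - a) + q * ((b * b - a * a) / 2))
    with (minus ((fun t => p * t + q * t ^ 2 / 2) b) ((fun t => p * t + q * t ^ 2 / 2) a))
    by (unfold minus, plus, opp; cbn; field).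
  apply (is_RInt_derive (V := R_CompleteNormedModule) (fun t => p * t + q * t ^ 2 / 2)).
  - intros t _; auto_derive; [easy | field].
  - intros t _.
    apply (ex_derive_continuous (V := R_NormedModule)); auto_derive; easy. }
destruct p as [p1 p2], q as [q1 q2]; unfold cint.
apply injective_projections; cbn [fst snd].
- refine (eq_trans (eq_trans _ (Q p1 q1)) _); [apply RInt_ext; intros t _ |];
    unfold Re, Im, Cplus, Cmult, RtoC; cbn; ring.
- refine (eq_trans (eq_trans _ (Q p2 q2)) _); [apply RInt_ext; intros t _ |];
    unfold Re, Im, Cplus, Cmult, RtoC; cbn; ring.
Qed.

Definition oint (f : C -> C) (x0 x1 y0 y1 : R) : C :=
  (cint (fun x => f (x, y0)) x0 x1 - cint (fun x => f (x, y1)) x0 x1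
   + Ci * (cint (fun y => f (x1, y)) y0 y1 - cint (fun y => f (x0, y)) y0 y1))%C.

Definition edge (x0 x1 y0 y1 : R) (z : C) : Prop :=
  (x0 <= Re z <= x1 /\ (Im z = y0 \/ Im z = y1)) \/
  ((Re z = x0 \/ Re z = x1) /\ y0 <= Im z <= y1).

Lemma horizontal_pcont f a b y :
  (forall x, a <= x <= b -> ccont f (x, y)) -> pcont (fun x => f (x, y)) a b.
Proof.
intros F t Ht; specialize (F t Ht); rewrite ccontE in F.
split; intros P [e He]; destruct (F e (cond_pos e)) as (d & d0 & Hd);
exists (mkposreal d d0); intros x Hx; apply He;
(assert (Hm : Cmod ((x, y) - (t, y))%C < d);
  [ replace ((x, y) - (t, y))%C with (RtoC (x - t))
      by (unfold RtoC, Cminus, Cplus, Copp; cbn; f_equal; ring);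
    rewrite Cmod_R; exact Hx |]);
apply Hd in Hm; (eapply Rle_lt_trans; [| exact Hm]).
- apply (Re_le_Cmod (f (x, y) - f (t, y))%C).
- apply (Im_le_Cmod (f (x, y) - f (t, y))%C).
Qed.

Lemma vertical_pcont f a b x :
  (forall y, a <= y <= b -> ccont f (x, y)) -> pcont (fun y => f (x, y)) a b.
Proof.
intros F t Ht; specialize (F t Ht); rewrite ccontE in F.
split; intros P [e He]; destruct (F e (cond_pos e)) as (d & d0 & Hd);
exists (mkposreal d d0); intros y Hy; apply He;
(assert (Hm : Cmod ((x, y) - (x, t))%C < d);
  [ eapply Rle_lt_trans; [apply Cmod_le_sum |]; unfold Re, Im; cbn;
    replace (x + - x) with 0 by ring; rewrite Rabs_R0, Rplus_0_l; exact Hy |]);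
apply Hd in Hm; (eapply Rle_lt_trans; [| exact Hm]).
- apply (Re_le_Cmod (f (x, y) - f (x, t))%C).
- apply (Im_le_Cmod (f (x, y) - f (x, t))%C).
Qed.

Section Rect.
Variables x0 x1 y0 y1 : R.
Hypotheses (hx : x0 <= x1) (hy : y0 <= y1).

Lemma edge_pcont f : (forall z, edge x0 x1 y0 y1 z -> ccont f z) ->
  pcont (fun x => f (x, y0)) x0 x1 /\ pcont (fun x => f (x, y1)) x0 x1 /\
  pcont (fun y => f (x0, y)) y0 y1 /\ pcont (fun y => f (x1, y)) y0 y1.
Proof.
intros F; split; [| split; [| split]]; (apply horizontal_pcont || apply vertical_pcont);
  intros t Ht; apply F; unfold edge, Re, Im; cbn; tauto.
Qed.

Lemma oint_ext f g : (forall z, edge x0 x1 y0 y1 z -> f z = g z) ->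
  oint f x0 x1 y0 y1 = oint g x0 x1 y0 y1.
Proof.
intros E; unfold oint.
rewrite (cint_ext (fun x => f (x, y0)) (fun x => g (x, y0))),
  (cint_ext (fun x => f (x, y1)) (fun x => g (x, y1))),
  (cint_ext (fun y => f (x0, y)) (fun y => g (x0, y))),
  (cint_ext (fun y => f (x1, y)) (fun y => g (x1, y))); try easy;
  intros t Ht; apply E; unfold edge, Re, Im; cbn; tauto.
Qed.

Lemma oint_plus f g :
  (forall z, edge x0 x1 y0 y1 z -> ccont f z) ->
  (forall z, edge x0 x1 y0 y1 z -> ccont g z) ->
  oint (fun z => f z + g z)%C x0 x1 y0 y1
  = (oint f x0 x1 y0 y1 + oint g x0 x1 y0 y1)%C.
Proof.
intros F G.
destruct (edge_pcont f F) as (F1 & F2 & F3 & F4).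
destruct (edge_pcont g G) as (G1 & G2 & G3 & G4).
unfold oint; rewrite !cint_plus by assumption; ring.
Qed.

Lemma oint_scal c f : (forall z, edge x0 x1 y0 y1 z -> ccont f z) ->
  oint (fun z => c * f z)%C x0 x1 y0 y1 = (c * oint f x0 x1 y0 y1)%C.
Proof.
intros F; destruct (edge_pcont f F) as (F1 & F2 & F3 & F4).
unfold oint; rewrite !cint_scal by assumption; ring.
Qed.

Lemma oint_bound f M : (forall z, edge x0 x1 y0 y1 z -> ccont f z) ->
  (forall z, edge x0 x1 y0 y1 z -> Cmod (f z) <= M) ->
  Cmod (oint f x0 x1 y0 y1) <= 4 * M * ((x1 - x0) + (y1 - y0)).
Proof.
intros F B; destruct (edge_pcont f F) as (F1 & F2 & F3 & F4).
pose proof (cint_bound _ _ _ M hx F1) as B1.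
pose proof (cint_bound _ _ _ M hx F2) as B2.
pose proof (cint_bound _ _ _ M hy F3) as B3.
pose proof (cint_bound _ _ _ M hy F4) as B4.
unfold oint.
eapply Rle_trans; [apply Cmod_triangle |].
rewrite Cmod_mult.
replace (Cmod Ci) with 1
  by (unfold Cmod, Ci; cbn; rewrite <- sqrt_1 at 1; f_equal; ring).
assert (T : forall a b : C, Cmod (a - b) <= Cmod a + Cmod b).
{ intros a b; eapply Rle_trans; [apply Cmod_triangle |]; rewrite Cmod_opp; lra. }
pose proof (T (cint (fun x => f (x, y0)) x0 x1) (cint (fun x => f (x, y1)) x0 x1)).
pose proof (T (cint (fun x => f (x1, x)) y0 y1) (cint (fun x => f (x0, x)) y0 y1)).
assert (E : forall t : C, edge x0 x1 y0 y1 t -> Cmod (f t) <= M) by easy.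
lapply B1; [| intros t Ht; apply E; unfold edge, Re, Im; cbn; tauto].
lapply B2; [| intros t Ht; apply E; unfold edge, Re, Im; cbn; tauto].
lapply B3; [| intros t Ht; apply E; unfold edge, Re, Im; cbn; tauto].
lapply B4; [| intros t Ht; apply E; unfold edge, Re, Im; cbn; tauto].
lra.
Qed.

Lemma oint_affine (c l : C) : oint (fun z => c + l * z)%C x0 x1 y0 y1 = 0.
Proof.
assert (E : forall x y : R, (x, y) = (RtoC x + Ci * RtoC y)%C)
  by (intros; unfold RtoC, Ci, Cplus, Cmult; cbn; f_equal; ring).
unfold oint.
rewrite (cint_ext _ (fun t => (c + l * Ci * RtoC y0) + l * RtoC t)%C x0 x1),
  (cint_ext (fun t => c + l * (t, y1))%C
    (fun t => (c + l * Ci * RtoC y1) + l * RtoC t)%C x0 x1),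
  (cint_ext _ (fun t => (c + l * RtoC x1) + (l * Ci) * RtoC t)%C y0 y1),
  (cint_ext (fun t => c + l * (x0, t))%C
    (fun t => (c + l * RtoC x0) + (l * Ci) * RtoC t)%C y0 y1)
  by (easy || (intros; rewrite E; ring)).
rewrite !cint_affine.
destruct c, l; unfold Cplus, Cminus, Cmult, Copp, Ci, RtoC; cbn; f_equal; field.
Qed.

End Rect.

Lemma oint_split_x f x0 xm x1 y0 y1 : x0 <= xm <= x1 -> y0 <= y1 ->
  (forall z, x0 <= Re z <= x1 -> y0 <= Im z <= y1 -> ccont f z) ->
  oint f x0 x1 y0 y1 = (oint f x0 xm y0 y1 + oint f xm x1 y0 y1)%C.
Proof.
intros hx hy F; unfold oint.
rewrite <- (cint_chasles (fun x => f (x, y0)) x0 xm x1),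
  <- (cint_chasles (fun x => f (x, y1)) x0 xm x1); try easy; [ring | |];
  apply horizontal_pcont; intros x Hx; apply F; unfold Re, Im; cbn; lra.
Qed.

Lemma oint_split_y f x0 x1 y0 ym y1 : y0 <= ym <= y1 -> x0 <= x1 ->
  (forall z, x0 <= Re z <= x1 -> y0 <= Im z <= y1 -> ccont f z) ->
  oint f x0 x1 y0 y1 = (oint f x0 x1 y0 ym + oint f x0 x1 ym y1)%C.
Proof.
intros hy hx F; unfold oint.
rewrite <- (cint_chasles (fun y => f (x0, y)) y0 ym y1),
  <- (cint_chasles (fun y => f (x1, y)) y0 ym y1); try easy; [ring | |];
  apply vertical_pcont; intros x Hx; apply F; unfold Re, Im; cbn; lra.
Qed.

(** * Goursat's lemma *)

Lemma nested_intervals (u v : nat -> R) (w : R) :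
  (forall n, u n <= u (S n)) -> (forall n, v (S n) <= v n) ->
  (forall n, v n - u n = w * (/ 2) ^ n) ->
  exists c, (forall n, u n <= c <= v n).
Proof.
intros Iu Dv W.
destruct (ex_lim_seq_adj u v Iu Dv) as ([c Hc] & [c' Hc'] & E).
{ apply (is_lim_seq_ext (fun n => w * (/ 2) ^ n)); [now intros; rewrite W |].
  replace (Finite 0) with (Rbar_mult w 0) by (cbn; f_equal; ring).
  apply is_lim_seq_scal_l, is_lim_seq_geom; rewrite Rabs_right; lra. }
rewrite (is_lim_seq_unique _ _ Hc), (is_lim_seq_unique _ _ Hc') in E.
injection E as <-.
exists c; intros n; split.
- exact (is_lim_seq_incr_compare u c Hc Iu n).
- exact (is_lim_seq_decr_compare v c Hc' Dv n).
Qed.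

(** A property of rectangles passes to the whole rectangle if it is inherited from
    the four quarters and holds for all small rectangles around each point: otherwise
    a nested sequence of bad rectangles shrinks to a point. *)
Lemma bisection (P : R -> R -> R -> R -> Prop) (x0 x1 y0 y1 : R) :
  x0 <= x1 -> y0 <= y1 ->
  (forall a b c d, x0 <= a -> b <= x1 -> y0 <= c -> d <= y1 -> a <= b -> c <= d ->
    P a ((a + b) / 2) c ((c + d) / 2) -> P ((a + b) / 2) b c ((c + d) / 2) ->
    P a ((a + b) / 2) ((c + d) / 2) d -> P ((a + b) / 2) b ((c + d) / 2) d ->
    P a b c d) ->
  (forall x y, x0 <= x <= x1 -> y0 <= y <= y1 -> exists del, 0 < del /\
    forall a b c d, x0 <= a <= x -> x <= b <= x1 -> y0 <= c <= y -> y <= d <= y1 ->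
      b - a < del -> d - c < del -> P a b c d) ->
  P x0 x1 y0 y1.
Proof.
intros hx hy Hsplit Hloc; apply NNPP; intros N.
pose (badr := fun s : R * R * R * R => let '(a, b, c, d) := s in
  x0 <= a /\ a <= b /\ b <= x1 /\ y0 <= c /\ c <= d /\ d <= y1 /\ ~ P a b c d).
pose (child := fun s t : R * R * R * R =>
  let '(a, b, c, d) := s in let '(a', b', c', d') := t in
  a <= a' /\ b' <= b /\ b' - a' = (b - a) * / 2 /\
  c <= c' /\ d' <= d /\ d' - c' = (d - c) * / 2).
assert (H : forall s : {s | badr s}, exists t : {s | badr s},
  child (proj1_sig s) (proj1_sig t)).
{ intros [[[[a b] c] d] (A1 & A2 & A3 & A4 & A5 & A6 & A7)]; cbn [proj1_sig].
  pose (m := (a + b) / 2); pose (n := (c + d) / 2).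
  assert (K : exists t, badr t /\ child (a, b, c, d) t).
  { destruct (classic (P a m c n)) as [Q1 |]; [| exists (a, m, c, n)].
    destruct (classic (P m b c n)) as [Q2 |]; [| exists (m, b, c, n)].
    destruct (classic (P a m n d)) as [Q3 |]; [| exists (a, m, n, d)].
    destruct (classic (P m b n d)) as [Q4 |]; [| exists (m, b, n, d)].
    now exfalso; apply A7, Hsplit.
    all: unfold badr, child, m, n in *; repeat split; assumption || lra. }
  destruct K as (t & T1 & T2); now exists (exist _ t T1). }
destruct (choice (fun s t : {s | badr s} => child (proj1_sig s) (proj1_sig t)) H) as [nxt Hn].
assert (B0 : badr (x0, x1, y0, y1)) by (unfold badr; repeat split; assumption || lra).
pose (s := fun n => Nat.iter n nxt (exist _ _ B0)).
pose (ga := fun q : R * R * R * R => let '(a, b, c, d) := q in a).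
pose (gb := fun q : R * R * R * R => let '(a, b, c, d) := q in b).
pose (gc := fun q : R * R * R * R => let '(a, b, c, d) := q in c).
pose (gd := fun q : R * R * R * R => let '(a, b, c, d) := q in d).
assert (Hs : forall n, child (proj1_sig (s n)) (proj1_sig (s (S n)))).
{ intros n; apply Hn. }
assert (W : forall n,
  gb (proj1_sig (s n)) - ga (proj1_sig (s n)) = (x1 - x0) * (/ 2) ^ n /\
  gd (proj1_sig (s n)) - gc (proj1_sig (s n)) = (y1 - y0) * (/ 2) ^ n).
{ induction n as [| n [I1 I2]]; [cbn; lra |].
  specialize (Hs n).
  destruct (proj1_sig (s n)) as [[[a b] c] d].
  destruct (proj1_sig (s (S n))) as [[[a' b'] c'] d'].
  cbn in Hs, I1, I2 |- *.
  destruct Hs as (_ & _ & E1 & _ & _ & E2); rewrite E1, E2, I1, I2; lra. }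
destruct (nested_intervals (fun n => ga (proj1_sig (s n)))
  (fun n => gb (proj1_sig (s n))) (x1 - x0)) as [x Hx].
{ intros n; specialize (Hs n).
  destruct (proj1_sig (s n)) as [[[a b] c] d].
  destruct (proj1_sig (s (S n))) as [[[a' b'] c'] d']; cbn in *; tauto. }
{ intros n; specialize (Hs n).
  destruct (proj1_sig (s n)) as [[[a b] c] d].
  destruct (proj1_sig (s (S n))) as [[[a' b'] c'] d']; cbn in *; tauto. }
{ intros n; apply W. }
destruct (nested_intervals (fun n => gc (proj1_sig (s n)))
  (fun n => gd (proj1_sig (s n))) (y1 - y0)) as [y Hy].
{ intros n; specialize (Hs n).
  destruct (proj1_sig (s n)) as [[[a b] c] d].
  destruct (proj1_sig (s (S n))) as [[[a' b'] c'] d']; cbn in *; tauto. }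
{ intros n; specialize (Hs n).
  destruct (proj1_sig (s n)) as [[[a b] c] d].
  destruct (proj1_sig (s (S n))) as [[[a' b'] c'] d']; cbn in *; tauto. }
{ intros n; apply W. }
destruct (Hloc x y) as (del & del0 & Hdel);
  [specialize (Hx O); cbn in Hx; lra | specialize (Hy O); cbn in Hy; lra |].
destruct (pow_lt_1_zero (/ 2)) with (y := del / (1 + (x1 - x0) + (y1 - y0)))
  as [n0 Hn0].
{ rewrite Rabs_right; lra. }
{ apply Rdiv_lt_0_compat; lra. }
specialize (Hn0 n0 (le_n _)).
assert (p0 : 0 < (/ 2) ^ n0) by (apply pow_lt; lra).
rewrite Rabs_right in Hn0 by lra.
apply Rlt_div_r in Hn0; [| lra].
destruct (W n0) as [W1 W2]; specialize (Hx n0); specialize (Hy n0).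
pose proof (proj2_sig (s n0)) as Bn; cbv beta in Bn.
destruct (proj1_sig (s n0)) as [[[a b] c] d]; cbn in *.
destruct Bn as (B1 & B2 & B3 & B4 & B5 & B6 & B7).
apply B7, Hdel; try lra; nra.
Qed.

(** The bound 4 eps (width + height)^2 on the integral is inherited from the quarters.
    On a small rectangle around a point it holds because the affine approximation of f
    there has integral 0. *)
Lemma goursat f x0 x1 y0 y1 : x0 <= x1 -> y0 <= y1 ->
  (forall z, x0 <= Re z <= x1 -> y0 <= Im z <= y1 -> cdiff f z) ->
  oint f x0 x1 y0 y1 = 0.
Proof.
intros hx hy F.
assert (Fc : forall z, x0 <= Re z <= x1 -> y0 <= Im z <= y1 -> ccont f z)
  by (intros; now apply cdiff_cont, F).
enough (K : forall eps, 0 < eps ->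
  Cmod (oint f x0 x1 y0 y1) <= 4 * eps * ((x1 - x0) + (y1 - y0)) ^ 2).
{ apply Cmod_eq_0, Rle_antisym; [| apply Cmod_ge_0].
  apply Rnot_lt_le; intros N.
  set (L := ((x1 - x0) + (y1 - y0)) ^ 2) in *.
  assert (L0 : 0 <= L) by apply pow2_ge_0.
  pose proof (K (Cmod (oint f x0 x1 y0 y1) / (8 * (L + 1)))) as K1.
  lapply K1; [clear K1; intros K1 | apply Rdiv_lt_0_compat; lra].
  assert (Cmod (oint f x0 x1 y0 y1) / (8 * (L + 1)) * (8 * (L + 1))
    = Cmod (oint f x0 x1 y0 y1)) by (field; lra).
  assert (0 < Cmod (oint f x0 x1 y0 y1) / (8 * (L + 1)))
    by (apply Rdiv_lt_0_compat; lra).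
  nra. }
intros eps He.
apply (bisection (fun a b c d =>
  Cmod (oint f a b c d) <= 4 * eps * ((b - a) + (d - c)) ^ 2)); try assumption.
- intros a b c d A1 A2 A3 A4 A5 A6 P1 P2 P3 P4.
  rewrite (oint_split_x f a ((a + b) / 2) b c d); try lra;
    [| intros; apply Fc; lra].
  rewrite (oint_split_y f a ((a + b) / 2) c ((c + d) / 2) d); try lra;
    [| intros; apply Fc; lra].
  rewrite (oint_split_y f ((a + b) / 2) b c ((c + d) / 2) d); try lra;
    [| intros; apply Fc; lra].
  eapply Rle_trans; [apply Cmod_triangle |].
  eapply Rle_trans; [apply Rplus_le_compat; apply Cmod_triangle |].
  nra.
- intros x y Hx Hy.
  destruct (F (x, y) Hx Hy) as (phi & cphi & E).
  pose proof cphi as cphi'; rewrite ccontE in cphi'.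
  destruct (cphi' eps He) as (d & d0 & Hd).
  exists (d / 2); split; [lra |].
  intros a b c e Ha Hb Hc He' W1 W2.
  set (l := phi (x, y)) in *.
  pose (r := fun w => ((phi w - l) * (w - (x, y)))%C).
  assert (Er : forall w, f w = ((f (x, y) - l * (x, y)) + l * w + r w)%C).
  { intros w; rewrite E; unfold r; ring. }
  assert (Ca : forall z, ccont (fun w => (f (x, y) - l * (x, y)) + l * w)%C z).
  { intros z; apply ccont_plus, ccont_mult; apply ccont_const || apply ccont_id. }
  assert (Cr : forall z, edge a b c e z -> ccont r z).
  { intros z Hz.
    apply (ccont_ext (fun w => f w - ((f (x, y) - l * (x, y)) + l * w))%C).
    - intros w; rewrite Er; ring.
    - apply ccont_minus; [apply Fc | apply Ca]; destruct Hz; lra. }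
  assert (ab : a <= b) by lra; assert (ce : c <= e) by lra.
  rewrite (oint_ext a b c e ab ce f (fun w => (f (x, y) - l * (x, y)) + l * w + r w)%C)
    by (intros; apply Er).
  rewrite (oint_plus a b c e ab ce _ r) by auto.
  rewrite (oint_affine a b c e ab ce), Cplus_0_l.
  replace (4 * eps * (b - a + (e - c)) ^ 2)
    with (4 * (eps * ((b - a) + (e - c))) * ((b - a) + (e - c))) by ring.
  apply oint_bound; try lra; [assumption |].
  intros z Hz; unfold r; rewrite Cmod_mult.
  assert (B : Cmod (z - (x, y)) <= (b - a) + (e - c)).
  { eapply Rle_trans; [apply Cmod_le_sum |].
    apply Rplus_le_compat; apply Rabs_le; destruct z as [u v];
    unfold edge, Re, Im in *; cbn in *; lra. }
  apply Rmult_le_compat; try apply Cmod_ge_0; [| exact B].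
  apply Rlt_le, Hd; lra.
Qed.

(** * Cauchy's formula and local uniqueness *)

Lemma small_multiples (x K d : R) : 0 < d -> (forall t, 0 < t < d -> x <= t * K) -> x <= 0.
Proof.
intros d0 H; apply Rnot_lt_le; intros N.
pose proof (H (d / 2)) as H1.
assert (K0 : 0 < K) by nra.
pose proof (H (Rmin (d / 2) (x / (2 * K)))) as H2.
assert (Q : 0 < x / (2 * K)) by (apply Rdiv_lt_0_compat; lra).
lapply H2; [clear H2; intros H2 | split].
- assert (Rmin (d / 2) (x / (2 * K)) * K <= x / (2 * K) * K)
    by (apply Rmult_le_compat_r; [lra | apply Rmin_r]).
  replace (x / (2 * K) * K) with (x / 2) in H0 by (field; lra); lra.
- apply Rmin_case; lra.
- eapply Rle_lt_trans; [apply Rmin_l | lra].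
Qed.

(** The integral equals the one over an arbitrarily small square around c, which tends
    to 0 because k is bounded near c. *)
Lemma goursat_punctured k (c : C) x0 x1 y0 y1 :
  x0 < Re c < x1 -> y0 < Im c < y1 ->
  (forall z, x0 <= Re z <= x1 -> y0 <= Im z <= y1 -> ccont k z) ->
  (forall z, x0 <= Re z <= x1 -> y0 <= Im z <= y1 -> z <> c -> cdiff k z) ->
  oint k x0 x1 y0 y1 = 0.
Proof.
intros hx hy Kc Kd.
assert (Cc : ccont k c) by (apply Kc; lra).
rewrite ccontE in Cc; destruct (Cc 1 Rlt_0_1) as (d & d0 & Hd).
set (m := Rmin (d / 2) (Rmin (Rmin (Re c - x0) (x1 - Re c)) (Rmin (Im c - y0) (y1 - Im c)))).
assert (m0 : 0 < m) by (unfold m; repeat apply Rmin_case; lra).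
assert (M : m <= d / 2 /\ m <= Re c - x0 /\ m <= x1 - Re c /\ m <= Im c - y0 /\ m <= y1 - Im c).
{ unfold m; repeat split.
  - apply Rmin_l.
  - eapply Rle_trans; [apply Rmin_r |]; eapply Rle_trans; [apply Rmin_l |]; apply Rmin_l.
  - eapply Rle_trans; [apply Rmin_r |]; eapply Rle_trans; [apply Rmin_l |]; apply Rmin_r.
  - eapply Rle_trans; [apply Rmin_r |]; eapply Rle_trans; [apply Rmin_r |]; apply Rmin_l.
  - eapply Rle_trans; [apply Rmin_r |]; eapply Rle_trans; [apply Rmin_r |]; apply Rmin_r. }
destruct M as (M1 & M2 & M3 & M4 & M5).
apply Cmod_eq_0, Rle_antisym; [| apply Cmod_ge_0].
apply (small_multiples _ (16 * (Cmod (k c) + 1)) m m0).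
intros t Ht.
assert (off : forall z, Re z <= Re c - t \/ Re c + t <= Re z \/
  Im z <= Im c - t \/ Im c + t <= Im z -> z <> c) by (intros z Hz ->; lra).
rewrite (oint_split_x k x0 (Re c - t) x1); try lra; [| intros; apply Kc; lra].
rewrite (oint_split_x k (Re c - t) (Re c + t) x1); try lra; [| intros; apply Kc; lra].
rewrite (oint_split_y k (Re c - t) (Re c + t) y0 (Im c - t) y1); try lra;
  [| intros; apply Kc; lra].
rewrite (oint_split_y k (Re c - t) (Re c + t) (Im c - t) (Im c + t) y1); try lra;
  [| intros; apply Kc; lra].
rewrite (goursat k x0 (Re c - t)), (goursat k (Re c + t) x1),
  (goursat k (Re c - t) (Re c + t) y0 (Im c - t)),
  (goursat k (Re c - t) (Re c + t) (Im c + t) y1);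
  try lra; try (intros z Hz1 Hz2; apply Kd; try lra; apply off; lra).
rewrite !Cplus_0_l, !Cplus_0_r.
replace (t * (16 * (Cmod (k c) + 1))) with
  (4 * (Cmod (k c) + 1) * ((Re c + t - (Re c - t)) + (Im c + t - (Im c - t)))) by ring.
apply oint_bound; try lra.
- intros z [Hz | Hz]; apply Kc; lra.
- intros z Hz.
  assert (B : Cmod (z - c) < d).
  { eapply Rle_lt_trans; [apply Cmod_le_sum |].
    enough (Rabs (Re (z - c)) <= t /\ Rabs (Im (z - c)) <= t) by lra.
    split; apply Rabs_le; destruct z as [u v], c as [c1 c2];
    unfold edge, Re, Im in *; cbn in *; lra. }
  apply Hd in B; pose proof (Cmod_tri_inv (k z) (k c)); lra.
Qed.

Section Square.
Variables (z0 : C) (r : R).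
Hypothesis r0 : 0 < r.
Let sq (f : C -> C) : C := oint f (Re z0 - r) (Re z0 + r) (Im z0 - r) (Im z0 + r).
Let sqedge := edge (Re z0 - r) (Re z0 + r) (Im z0 - r) (Im z0 + r).

Lemma sq_dist w : sqedge w -> r <= Cmod (w - z0).
Proof.
intros Hw.
assert (r <= Rabs (Re (w - z0)) \/ r <= Rabs (Im (w - z0))) as [E | E].
{ destruct w as [w1 w2], z0 as [c1 c2]; unfold sqedge, edge, Re, Im in *; cbn in *.
  destruct Hw as [[_ [-> | ->]] | [[-> | ->] _]]; [right | right | left | left].
  - rewrite <- Rabs_Ropp, Rabs_right; lra.
  - rewrite Rabs_right; lra.
  - rewrite <- Rabs_Ropp, Rabs_right; lra.
  - rewrite Rabs_right; lra. }
- eapply Rle_trans; [exact E | apply Re_le_Cmod].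
- eapply Rle_trans; [exact E | apply Im_le_Cmod].
Qed.

Lemma sq_dist_near z w : Cmod (z - z0) < r / 2 -> sqedge w -> r / 2 <= Cmod (w - z).
Proof.
intros Hz Hw; apply sq_dist in Hw.
pose proof (Cmod_tri_inv (w - z0)%C (z - z0)%C) as T.
replace (w - z0 - (z - z0))%C with (w - z)%C in T by ring; lra.
Qed.

Lemma sq_neq z w : Cmod (z - z0) < r / 2 -> sqedge w -> w <> z.
Proof.
intros Hz Hw ->; pose proof (sq_dist_near z z Hz Hw) as T.
replace (z - z)%C with (RtoC 0) in T by ring; rewrite Cmod_0 in T; lra.
Qed.

(** This integral is 2 pi i, but only its being nonzero matters. *)
Definition kernel (z : C) : C := sq (fun w => / (w - z))%C.

Lemma near_inside z : Cmod (z - z0) < r / 2 ->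
  Re z0 - r < Re z < Re z0 + r /\ Im z0 - r < Im z < Im z0 + r.
Proof.
intros Hz.
pose proof (Rle_lt_trans _ _ _ (Re_le_Cmod _) Hz) as A1.
pose proof (Rle_lt_trans _ _ _ (Im_le_Cmod _) Hz) as A2.
apply Rabs_lt_between in A1, A2.
destruct z, z0; unfold Re, Im in *; cbn in *; lra.
Qed.

(** On each side of the square, the contribution to the imaginary part has a
    constant positive sign. *)
Lemma kernel_neq z : Cmod (z - z0) < r / 2 -> kernel z <> 0.
Proof.
intros Hz E.
enough (P : 0 < Im (kernel z)) by (rewrite E in P; unfold Im in P; cbn in P; lra).
assert (Cs : forall w, sqedge w -> ccont (fun w => / (w - z))%C w).
{ intros w Hw; apply ccont_inv_shift; now apply sq_neq. }
destruct (edge_pcont _ _ _ _ _ Cs) as (C1 & C2 & C3 & C4).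
destruct (near_inside z Hz) as [I1 I2].
set (x0 := Re z0 - r) in *; set (x1 := Re z0 + r) in *;
set (y0 := Im z0 - r) in *; set (y1 := Im z0 + r) in *.
assert (xx : x0 < x1) by (unfold x0, x1; lra).
assert (yy : y0 < y1) by (unfold y0, y1; lra).
assert (pos : forall g a b, a < b -> (forall t, a <= t <= b -> continuous g t) ->
  (forall t, a < t < b -> 0 < g t) -> 0 < RInt g a b).
{ intros g a b ab Hg Pg; now apply RInt_gt_0. }
assert (neg : forall g a b, a < b -> (forall t, a <= t <= b -> continuous g t) ->
  (forall t, a < t < b -> g t < 0) -> RInt g a b < 0).
{ intros g a b ab Hg Pg.
  assert (Q := RInt_lt g (fun _ => 0) a b ab (fun t _ => continuous_const 0 t) Hg Pg).
  assert (Z : RInt (fun _ : R => 0) a b = 0)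
    by exact (eq_trans (RInt_const a b 0) (Rmult_0_r (b - a))).
  rewrite Z in Q; exact Q. }
destruct z as [a b]; unfold Re, Im in I1, I2; cbn [fst snd] in I1, I2.
assert (den : forall x y, y <> b \/ x <> a -> 0 < (x - a) * (x - a) + (y - b) * (y - b)).
{ intros x y [N | N].
  - assert (0 < (y - b) * (y - b)) by (apply Rsqr_pos_lt; lra).
    pose proof (Rle_0_sqr (x - a)) as G; unfold Rsqr in G; lra.
  - assert (0 < (x - a) * (x - a)) by (apply Rsqr_pos_lt; lra).
    pose proof (Rle_0_sqr (y - b)) as G; unfold Rsqr in G; lra. }
assert (S1 : 0 < RInt (fun x => Im (/ ((x, y0) - (a, b)))%C) x0 x1).
{ apply pos; [easy | apply C1 |]; intros x _.
  unfold Im, Cinv; cbn; apply Rdiv_lt_0_compat; [lra |].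
  pose proof (den x y0); lra. }
assert (S2 : RInt (fun x => Im (/ ((x, y1) - (a, b)))%C) x0 x1 < 0).
{ apply neg; [easy | apply C2 |]; intros x _.
  unfold Im, Cinv; cbn.
  apply Ropp_lt_cancel; rewrite Ropp_0; unfold Rdiv; rewrite Ropp_mult_distr_l.
  apply Rdiv_lt_0_compat; [lra |].
  pose proof (den x y1); lra. }
assert (S3 : 0 < RInt (fun y => Re (/ ((x1, y) - (a, b)))%C) y0 y1).
{ apply pos; [easy | apply C4 |]; intros y _.
  unfold Re, Cinv; cbn; apply Rdiv_lt_0_compat; [lra |].
  pose proof (den x1 y); lra. }
assert (S4 : RInt (fun y => Re (/ ((x0, y) - (a, b)))%C) y0 y1 < 0).
{ apply neg; [easy | apply C3 |]; intros y _.
  unfold Re, Cinv; cbn.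
  apply Ropp_lt_cancel; rewrite Ropp_0; unfold Rdiv; rewrite Ropp_mult_distr_l.
  apply Rdiv_lt_0_compat; [lra |].
  pose proof (den x0 y); lra. }
assert (F : forall u v s t : C, Im (u - v + Ci * (s - t)) = Im u - Im v + (Re s - Re t)).
{ intros [] [] [] []; unfold Re, Im; cbn; ring. }
unfold kernel, sq, oint; rewrite F; unfold cint; fold x0 x1 y0 y1.
exact (Rplus_lt_0_compat _ _ (proj2 (Rlt_0_minus _ _) (Rlt_trans _ _ _ S2 S1))
  (proj2 (Rlt_0_minus _ _) (Rlt_trans _ _ _ S4 S3))).
Qed.

Variables (f : C -> C) (M : R).
Hypothesis fd : forall w, Re z0 - r <= Re w <= Re z0 + r ->
  Im z0 - r <= Im w <= Im z0 + r -> cdiff f w.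
Hypothesis fM : forall w, Re z0 - r <= Re w <= Re z0 + r ->
  Im z0 - r <= Im w <= Im z0 + r -> Cmod (f w) <= M.

Lemma sqedge_in w : sqedge w -> Re z0 - r <= Re w <= Re z0 + r /\
  Im z0 - r <= Im w <= Im z0 + r.
Proof. intros [H | H]; lra. Qed.

Lemma sq_hx : Re z0 - r <= Re z0 + r. Proof. lra. Qed.
Lemma sq_hy : Im z0 - r <= Im z0 + r. Proof. lra. Qed.

(** The difference quotient of f at z has integral 0. *)
Lemma cauchy_formula z : Cmod (z - z0) < r / 2 ->
  (f z * kernel z)%C = sq (fun w => f w * / (w - z))%C.
Proof.
intros Hz; destruct (near_inside z Hz) as [I1 I2].
destruct (dquot_cont_center f z) as [l Hl]; [apply fd; lra |].
assert (Z : sq (dquot f z l) = 0).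
{ unfold sq; apply (goursat_punctured (dquot f z l) z _ _ _ _ I1 I2).
  - intros w W1 W2; destruct (classic (w = z)) as [-> | N]; [exact Hl |].
    now apply cdiff_cont, dquot_cdiff, fd.
  - intros w W1 W2 N; now apply dquot_cdiff, fd. }
assert (Ci : forall w, sqedge w -> ccont (fun w => / (w - z))%C w).
{ intros w Hw; apply ccont_inv_shift; now apply sq_neq. }
assert (Cf : forall w, sqedge w -> ccont (fun w => f w * / (w - z))%C w).
{ intros w Hw; apply ccont_mult; [| now apply Ci].
  apply cdiff_cont, fd; apply sqedge_in, Hw. }
assert (E : sq (dquot f z l)
  = (sq (fun w => f w * / (w - z)) + - f z * kernel z)%C).
{ unfold kernel, sq.
  rewrite <- (oint_scal _ _ _ _ sq_hx sq_hy (- f z)%C) by exact Ci.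
  rewrite <- (oint_plus _ _ _ _ sq_hx sq_hy); [| exact Cf |].
  - apply (oint_ext _ _ _ _ sq_hx sq_hy); intros w Hw.
    rewrite dquot_neq by now apply sq_neq.
    unfold Cdiv; ring.
  - intros w Hw; apply ccont_mult; [apply ccont_const | now apply Ci]. }
rewrite Z in E.
replace (sq (fun w => f w * / (w - z)))%C
  with (sq (fun w => f w * / (w - z)) + - f z * kernel z + f z * kernel z)%C by ring.
rewrite <- E; ring.
Qed.

(** [divided n w] is f(w) / (w - z0)^n; its integral [rest n z] against 1 / (w - z) is the
    remainder of order n of the Taylor expansion of f at z0, up to the factors
    (z - z0)^n and [kernel]. *)
Fixpoint divided (n : nat) (w : C) : C :=
  match n with O => f w | S m => (divided m w * / (w - z0))%C end.

Lemma z0_near : Cmod (z0 - z0) < r / 2.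
Proof. replace (z0 - z0)%C with (RtoC 0) by ring; rewrite Cmod_0; lra. Qed.

Lemma divided_cont n w : sqedge w -> ccont (divided n) w.
Proof.
intros Hw; induction n as [| n IH].
- apply cdiff_cont, fd; apply sqedge_in, Hw.
- apply ccont_mult; [exact IH |].
  apply ccont_inv_shift, sq_neq; [exact z0_near | exact Hw].
Qed.

Lemma divided_bound n w : sqedge w -> Cmod (divided n w) <= M * (/ r) ^ n.
Proof.
intros Hw; induction n as [| n IH]; cbn [divided pow].
- rewrite Rmult_1_r; apply fM; apply sqedge_in, Hw.
- assert (N := sq_neq z0 w z0_near Hw).
  rewrite Cmod_mult, Cmod_inv by now apply Cminus_neq.
  replace (M * (/ r * (/ r) ^ n)) with (M * (/ r) ^ n * / r) by ring.
  apply Rmult_le_compat; [apply Cmod_ge_0 | | exact IH |].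
  + left; apply Rinv_0_lt_compat, Cmod_gt_0; now apply Cminus_neq.
  + apply Rinv_le_contravar; [exact r0 | now apply sq_dist].
Qed.

Definition rest (n : nat) (z : C) : C := sq (fun w => divided n w * / (w - z))%C.

Lemma rest_cont n z w : Cmod (z - z0) < r / 2 -> sqedge w ->
  ccont (fun w => divided n w * / (w - z))%C w.
Proof.
intros Hz Hw; apply ccont_mult; [now apply divided_cont |].
apply ccont_inv_shift; now apply sq_neq.
Qed.

Lemma rest_bound n z : Cmod (z - z0) < r / 2 -> Cmod (rest n z) <= 32 * M * (/ r) ^ n.
Proof.
intros Hz.
replace (32 * M * (/ r) ^ n) with (4 * (M * (/ r) ^ n * / (r / 2)) *
  ((Re z0 + r - (Re z0 - r)) + (Im z0 + r - (Im z0 - r)))) by (field; lra).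
unfold rest, sq; apply (oint_bound _ _ _ _ sq_hx sq_hy).
- intros w Hw; now apply rest_cont.
- intros w Hw; assert (N := sq_neq z w Hz Hw).
  rewrite Cmod_mult, Cmod_inv by now apply Cminus_neq.
  apply Rmult_le_compat; [apply Cmod_ge_0 | | now apply divided_bound |].
  + left; apply Rinv_0_lt_compat, Cmod_gt_0; now apply Cminus_neq.
  + apply Rinv_le_contravar; [lra | now apply sq_dist_near].
Qed.

(** 1 / (w - z) = 1 / (w - z0) + (z - z0) / ((w - z0) (w - z)). *)
Lemma rest_step n z : Cmod (z - z0) < r / 2 ->
  rest n z = (sq (divided (S n)) + (z - z0) * rest (S n) z)%C.
Proof.
intros Hz; unfold rest, sq.
rewrite <- (oint_scal _ _ _ _ sq_hx sq_hy); [| intros w Hw; now apply rest_cont].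
rewrite <- (oint_plus _ _ _ _ sq_hx sq_hy); [| intros w Hw; now apply divided_cont |].
- apply (oint_ext _ _ _ _ sq_hx sq_hy); intros w Hw; cbn [divided].
  assert (N := Cminus_neq _ _ (sq_neq z w Hz Hw)).
  assert (N0 := Cminus_neq _ _ (sq_neq z0 w z0_near Hw)).
  field; split; assumption.
- intros w Hw; apply ccont_mult; [apply ccont_const | now apply rest_cont].
Qed.

Variable del : R.
Hypothesis del0 : 0 < del.
Hypothesis fz : forall t, Rabs t < del -> f (z0 + RtoC t)%C = 0.

(** The n-th Taylor coefficient, which is the integral of [divided (S n)] up to a
    factor 2 pi i, vanishes: at the zeros z0 + t of f that integral is - t times a
    bounded quantity. *)
Lemma vanishing_order n z : Cmod (z - z0) < r / 2 ->
  (f z * kernel z)%C = (Cpow (z - z0) n * rest n z)%C.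
Proof.
revert z; induction n as [| n IH]; intros z Hz.
- rewrite cauchy_formula by exact Hz; cbn; unfold rest; cbn [divided]; ring.
- rewrite IH, rest_step by exact Hz.
  enough (E : sq (divided (S n)) = 0) by (rewrite E; cbn; ring).
  apply Cmod_eq_0, Rle_antisym; [| apply Cmod_ge_0].
  apply (small_multiples _ (32 * M * (/ r) ^ (S n)) (Rmin del (r / 2)));
    [apply Rmin_case; lra |].
  intros t Ht.
  assert (t1 := Rlt_le_trans _ _ _ (proj2 Ht) (Rmin_l _ _)).
  assert (t2 := Rlt_le_trans _ _ _ (proj2 Ht) (Rmin_r _ _)).
  assert (Ez : (z0 + RtoC t - z0)%C = RtoC t) by ring.
  assert (Hzt : Cmod (z0 + RtoC t - z0) < r / 2)
    by (rewrite Ez, Cmod_R, Rabs_right; lra).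
  pose proof (IH _ Hzt) as Et.
  rewrite fz, Cmult_0_l, rest_step, Ez in Et by (assumption || (rewrite Rabs_right; lra)).
  assert (Nt : RtoC t <> 0) by (intros A; injection A; lra).
  assert (Et' : (sq (divided (S n)) + RtoC t * rest (S n) (z0 + RtoC t))%C = 0).
  { apply NNPP; intros A; symmetry in Et; revert Et.
    apply Cmult_neq_0; [now apply Cpow_nz | exact A]. }
  replace (sq (divided (S n))) with (- (RtoC t * rest (S n) (z0 + RtoC t)))%C
    by (rewrite <- (Cplus_0_l (- _)%C), <- Et'; ring).
  rewrite Cmod_opp, Cmod_mult, Cmod_R, Rabs_right by lra.
  apply Rmult_le_compat_l; [lra | now apply rest_bound].
Qed.

(** The remainders are at most a constant times (|z - z0| / r)^n, hence tend to 0. *)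
Lemma local_uniqueness z : Cmod (z - z0) < r / 2 -> f z = 0.
Proof.
intros Hz.
enough (E : (f z * kernel z)%C = 0).
{ apply NNPP; intros N; revert E; apply Cmult_neq_0; [exact N | now apply kernel_neq]. }
assert (B : forall n, Cmod (f z * kernel z) <= 32 * M * (/ 2) ^ n).
{ intros n; rewrite (vanishing_order n z Hz), Cmod_mult.
  replace (Cmod (Cpow (z - z0) n)) with (Cmod (z - z0) ^ n).
  - eapply Rle_trans.
    + apply Rmult_le_compat; [apply pow_le, Cmod_ge_0 | apply Cmod_ge_0 | | apply rest_bound, Hz].
      apply pow_incr; split; [apply Cmod_ge_0 | left; exact Hz].
    + right; replace (/ 2) with (r / 2 * / r) by (field; lra).
      rewrite Rpow_mult_distr; ring.
  - induction n as [| n IH]; cbn; [now rewrite Cmod_1 | now rewrite Cmod_mult, IH]. }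
apply Cmod_eq_0, Rle_antisym; [| apply Cmod_ge_0].
change (Rbar_le (Cmod (f z * kernel z)) 0).
apply (is_lim_seq_le (fun _ => Cmod (f z * kernel z)) (fun n => 32 * M * (/ 2) ^ n)).
- exact B.
- apply is_lim_seq_const.
- replace (Finite 0) with (Rbar_mult (32 * M) 0) by (cbn; f_equal; ring).
  apply is_lim_seq_scal_l, is_lim_seq_geom; rewrite Rabs_right; lra.
Qed.

End Square.

(** * The identity theorem on a circular domain *)

Definition copen (W : C -> Prop) : Prop := forall z, W z ->
  exists eps, 0 < eps /\ forall w, Cmod (w - z) < eps -> W w.

Lemma conj_invariant_abs W a b : conj_invariant W -> W (a, b) -> W (a, Rabs b).
Proof.
intros HW Hb; unfold Rabs; destruct (Rcase_abs b); [exact (HW _ Hb) | exact Hb].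
Qed.

Lemma conj_invariant_absV W a b : conj_invariant W -> W (a, Rabs b) -> W (a, b).
Proof.
intros HW Hb; unfold Rabs in Hb; destruct (Rcase_abs b); [| exact Hb].
apply HW in Hb; unfold Cconj in Hb; cbn in Hb; now rewrite Ropp_involutive in Hb.
Qed.

Lemma Omega_iff W a x y z : conj_invariant W ->
  Omega W (a, x, y, z) <-> W (a, sqrt (x * x + y * y + z * z)).
Proof.
intros HW; split.
- intros (a' & b & J & Hb & HJ & E).
  destruct (imag_unit_inv J HJ) as (u & v & w & -> & N).
  revert E; Hunfold; intros E; injection E as -> -> -> ->.
  replace (a' + b * 0) with a' by ring.
  replace ((0 + b * u) * (0 + b * u) + (0 + b * v) * (0 + b * v) + (0 + b * w) * (0 + b * w))
    with (Rsqr b) by (unfold Rsqr; transitivity (b * b * (u * u + v * v + w * w));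
      [rewrite N |]; ring).
  rewrite sqrt_Rsqr_abs; now apply conj_invariant_abs.
- intros Hb; set (b := sqrt (x * x + y * y + z * z)) in *.
  assert (P : 0 <= x * x + y * y + z * z).
  { pose proof (Rle_0_sqr x); pose proof (Rle_0_sqr y); pose proof (Rle_0_sqr z);
    unfold Rsqr in *; lra. }
  assert (S : b * b = x * x + y * y + z * z) by now apply sqrt_sqrt.
  destruct (Req_dec b 0) as [Z | N].
  + exists a, b, (0, 1, 0, 0); split; [exact Hb | split; [exact imag_unit_i |]].
    rewrite Z in *.
    pose proof (Rle_0_sqr x); pose proof (Rle_0_sqr y); pose proof (Rle_0_sqr z);
    unfold Rsqr in *.
    assert (x = 0) by (apply Rsqr_0_uniq; unfold Rsqr; lra).
    assert (y = 0) by (apply Rsqr_0_uniq; unfold Rsqr; lra).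
    assert (z = 0) by (apply Rsqr_0_uniq; unfold Rsqr; lra).
    subst; Hunfold; apply H_ext; ring.
  + exists a, b, (0, x / b, y / b, z / b); split; [exact Hb | split].
    * unfold imag_unit; Hunfold; apply H_ext; try (field; exact N).
      apply (Rmult_eq_reg_r (b * b)); [| now apply Rmult_integral_contrapositive_currified].
      transitivity (- (x * x + y * y + z * z)); [field; exact N | rewrite <- S; ring].
    * Hunfold; apply H_ext; field; exact N.
Qed.

Lemma domain_open D : circular_domain D -> copen D.
Proof.
intros (HD & HO & _) [a b] Hz.
destruct (HO (a, b, 0, 0)) as [e He].
{ apply Omega_iff; [exact HD |].
  replace (b * b + 0 * 0 + 0 * 0) with (Rsqr b) by (unfold Rsqr; ring).
  rewrite sqrt_Rsqr_abs; now apply conj_invariant_abs. }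
exists e; split; [apply cond_pos |]; intros [a' b'] Hw.
assert (Q : Omega D (a', b', 0, 0)).
{ apply He; repeat split; try apply ball_center.
  - exact (Rle_lt_trans _ _ _ (Re_le_Cmod _) Hw).
  - exact (Rle_lt_trans _ _ _ (Im_le_Cmod _) Hw). }
apply Omega_iff in Q; [| exact HD].
replace (b' * b' + 0 * 0 + 0 * 0) with (Rsqr b') in Q by (unfold Rsqr; ring).
rewrite sqrt_Rsqr_abs in Q; now apply conj_invariant_absV.
Qed.

Definition vnorm (q : H) : R :=
  sqrt (snd (fst (fst q)) * snd (fst (fst q)) + snd (fst q) * snd (fst q) + snd q * snd q).

Lemma vnorm_continuous q : continuous vnorm q.
Proof.
assert (C1 : continuous (fun q : H => snd (fst (fst q))) q).
{ apply (continuous_comp (fun q : H => fst q) (fun p : R * R * R => snd (fst p)));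
    [apply continuous_fst |].
  apply (continuous_comp (fun p : R * R * R => fst p) (fun p : R * R => snd p));
    [apply continuous_fst | apply continuous_snd]. }
assert (C2 : continuous (fun q : H => snd (fst q)) q).
{ apply (continuous_comp (fun q : H => fst q) (fun p : R * R * R => snd p));
    [apply continuous_fst | apply continuous_snd]. }
assert (C3 : continuous (fun q : H => snd q) q) by apply continuous_snd.
assert (M : forall f : H -> R, continuous f q -> continuous (fun q => f q * f q) q).
{ intros f F; exact (continuous_mult f f q F F). }
assert (P : forall f g : H -> R, continuous f q -> continuous g q ->
  continuous (fun q => f q + g q) q).
{ intros f g F G; exact (continuous_plus f g q F G). }
apply (continuous_comp (fun q : H => snd (fst (fst q)) * snd (fst (fst q)) +
  snd (fst q) * snd (fst q) + snd q * snd q) sqrt); [| apply continuous_sqrt].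
apply P; [apply P |]; now apply M.
Qed.

(** Connectedness is assumed for the domain in H; this lemma transports open subsets of
    the plane to H. *)
Lemma Omega_open W : conj_invariant W -> copen W -> open (Omega W).
Proof.
intros HW OW [[[a x] y] z] Hq.
apply Omega_iff in Hq; [| exact HW].
destruct (OW _ Hq) as (e & e0 & He).
assert (e2 : 0 < e / 2) by lra.
destruct (vnorm_continuous (a, x, y, z) (ball (vnorm (a, x, y, z)) (mkposreal _ e2)))
  as [d Hd]; [apply locally_ball |].
exists (mkposreal (Rmin d (e / 2)) (Rmin_pos _ _ (cond_pos d) e2)).
intros [[[a' x'] y'] z'] Hq'.
assert (Hv : ball (vnorm (a, x, y, z)) (e / 2) (vnorm (a', x', y', z'))).
{ apply Hd, (ball_le _ _ _ (Rmin_l d (e / 2)) _ Hq'). }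
destruct Hq' as [[[Ha _] _] _].
assert (Ha' : ball a (e / 2) a').
{ apply (ball_le _ _ _ (Rmin_r d (e / 2)) _ Ha). }
apply Omega_iff; [exact HW | apply He].
eapply Rle_lt_trans; [apply Cmod_le_sum |].
replace e with (e / 2 + e / 2) by field; apply Rplus_lt_compat; [exact Ha' | exact Hv].
Qed.

Lemma edge_ball (w0 w : C) r :
  Re w0 - r <= Re w <= Re w0 + r -> Im w0 - r <= Im w <= Im w0 + r ->
  Cmod (w - w0) <= 2 * r.
Proof.
intros H1 H2; eapply Rle_trans; [apply Cmod_le_sum |].
enough (Rabs (Re (w - w0)) <= r /\ Rabs (Im (w - w0)) <= r) by lra.
destruct w, w0; unfold Re, Im in *; cbn in *; split; apply Rabs_le; lra.
Qed.

Lemma Cmod_tri3 (a b c : C) : Cmod (a - c) <= Cmod (a - b) + Cmod (b - c).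
Proof. replace (a - c)%C with ((a - b) + (b - c))%C by ring; apply Cmod_triangle. Qed.

(** The set W of points near which h vanishes is open and closed in D.  The symmetry of
    h makes W invariant under conjugation, so that W and its complement define open
    circular sets separating the domain of H. *)
Theorem identity_theorem D h : circular_domain D ->
  (forall z, D z -> cdiff h z) ->
  (forall z, D z -> h (Cconj z) = Cconj (h z)) ->
  forall (z0 : C) del, D z0 -> 0 < del ->
  (forall t, Rabs t < del -> h (z0 + RtoC t)%C = 0) ->
  forall z, D z -> h z = 0.
Proof.
intros HD hd hc z0 del Dz0 del0 hz.
pose proof (domain_open D HD) as OD.
destruct HD as (HI & _ & Hcon).
(* A neighbourhood of z small enough that any zero segment in it forces h = 0 on all
   of it: the radius must depend on z only, for the closedness of W. *)
assert (Loc : forall z, D z -> exists e, 0 < e /\ forall w, Cmod (w - z) < e ->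
  forall d, 0 < d -> (forall t, Rabs t < d -> h (w + RtoC t)%C = 0) ->
  forall v, Cmod (v - z) < e -> h v = 0).
{ intros z Dz.
  destruct (OD z Dz) as (e1 & e1p & He1).
  pose proof (cdiff_cont _ _ (hd z Dz)) as hc1; rewrite ccontE in hc1.
  destruct (hc1 1 Rlt_0_1) as (e2 & e2p & He2).
  set (e := Rmin e1 e2).
  assert (ep : 0 < e) by (apply Rmin_case; assumption).
  exists (e / 16); split; [lra |].
  intros w Hw d dp hw v Hv.
  assert (In : forall u, Re w - e / 4 <= Re u <= Re w + e / 4 ->
    Im w - e / 4 <= Im u <= Im w + e / 4 -> Cmod (u - z) < e).
  { intros u U1 U2; pose proof (edge_ball _ _ _ U1 U2); pose proof (Cmod_tri3 u w z); lra. }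
  apply (local_uniqueness w (e / 4)) with (f := h) (M := Cmod (h z) + 1) (del := d);
    try lra; try assumption.
  - intros u U1 U2; apply hd, He1, (Rlt_le_trans _ _ _ (In u U1 U2)), Rmin_l.
  - intros u U1 U2.
    pose proof (He2 u (Rlt_le_trans _ _ _ (In u U1 U2) (Rmin_r _ _))).
    pose proof (Cmod_tri_inv (h u) (h z)); lra.
  - pose proof (Cmod_tri3 v z w); rewrite (Cmod_minus_sym z w) in H; lra. }
pose (W := fun z => D z /\ exists e, 0 < e /\ forall w, Cmod (w - z) < e -> h w = 0).
assert (Sub : forall z e w, (forall v, Cmod (v - z) < e -> h v = 0) ->
  Cmod (w - z) < e -> exists e, 0 < e /\ forall v, Cmod (v - w) < e -> h v = 0).
{ intros z e w He Hw; exists (e - Cmod (w - z)); split; [lra |].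
  intros v Hv; apply He; pose proof (Cmod_tri3 v w z); lra. }
assert (conjmod : forall z w, Cmod (Cconj z - w) = Cmod (z - Cconj w)).
{ intros [] []; unfold Cconj, Cmod; cbn; f_equal; ring. }
assert (HW : conj_invariant W).
{ intros z (Dz & e & e0 & He); split; [now apply HI |].
  destruct (OD z Dz) as (e' & e'0 & He').
  exists (Rmin e e'); split; [now apply Rmin_case |]; intros w Hw.
  assert (Hw' : Cmod (Cconj w - z) < Rmin e e') by now rewrite conjmod.
  rewrite <- (Cconj_conj w), hc.
  - rewrite He; [unfold Cconj; cbn; now rewrite Ropp_0 |].
    apply (Rlt_le_trans _ _ _ Hw'), Rmin_l.
  - apply He', (Rlt_le_trans _ _ _ Hw'), Rmin_r. }
assert (OW : copen W).
{ intros z (Dz & e & e0 & He).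
  destruct (OD z Dz) as (e' & e'0 & He').
  exists (Rmin e e'); split; [now apply Rmin_case |]; intros w Hw; split.
  - apply He', (Rlt_le_trans _ _ _ Hw), Rmin_r.
  - apply (Sub z e w He), (Rlt_le_trans _ _ _ Hw), Rmin_l. }
pose (V := fun z => D z /\ ~ W z).
assert (HV : conj_invariant V).
{ intros z (Dz & N); split; [now apply HI |]; intros Wz; apply N.
  apply HW in Wz; now rewrite Cconj_conj in Wz. }
assert (OV : copen V).
{ intros z (Dz & N).
  destruct (OD z Dz) as (e' & e'0 & He').
  destruct (Loc z Dz) as (e & e0 & He).
  exists (Rmin e e'); split; [now apply Rmin_case |]; intros w Hw; split.
  { apply He', (Rlt_le_trans _ _ _ Hw), Rmin_r. }
  intros (Dw & d & d0 & Hd); apply N; split; [exact Dz |].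
  exists e; split; [exact e0 |].
  apply (He w (Rlt_le_trans _ _ _ Hw (Rmin_l _ _)) d d0).
  intros t Ht; apply Hd.
  replace (w + RtoC t - w)%C with (RtoC t) by ring; now rewrite Cmod_R. }
assert (W0 : W z0).
{ split; [exact Dz0 |]; destruct (Loc z0 Dz0) as (e & e0 & He).
  exists e; split; [exact e0 |]; apply (He z0) with (d := del); try assumption.
  replace (z0 - z0)%C with (RtoC 0) by ring; now rewrite Cmod_0. }
intros z Dz; apply NNPP; intros N.
assert (Vz : V z).
{ split; [exact Dz |]; intros (_ & e & e0 & He); apply N, He.
  replace (z - z)%C with (RtoC 0) by ring; now rewrite Cmod_0. }
assert (lift : forall (X : C -> Prop) (z : C), conj_invariant X -> X z ->
  Omega X (Re z, Im z, 0, 0)).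
{ intros X [a b] HX Xz; apply Omega_iff; [exact HX |]; unfold Re, Im; cbn [fst snd].
  replace (b * b + 0 * 0 + 0 * 0) with (Rsqr b) by (unfold Rsqr; ring).
  rewrite sqrt_Rsqr_abs; now apply conj_invariant_abs. }
destruct (Hcon (Omega W) (Omega V)) as ([[[a x] y] u] & _ & Q1 & Q2).
- now apply Omega_open.
- now apply Omega_open.
- intros [[[a x] y] u] Q; rewrite !Omega_iff in * by assumption.
  destruct (classic (W (a, sqrt (x * x + y * y + u * u)))); [now left | right; split; assumption].
- exists (Re z0, Im z0, 0, 0); split; apply lift; assumption.
- exists (Re z, Im z, 0, 0); split; apply lift; assumption.
- apply Omega_iff in Q1; [| exact HW]; apply Omega_iff in Q2; [| exact HV].
  now destruct Q2.
Qed.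

(** * The exponential of the complex quaternions *)

Definition h0 (X : HC) : C := fst (fst (fst X)).
Definition h1 (X : HC) : C := snd (fst (fst X)).
Definition h2 (X : HC) : C := snd (fst X).
Definition h3 (X : HC) : C := snd X.
Definition HCadd (X Y : HC) : HC := (h0 X + h0 Y, h1 X + h1 Y, h2 X + h2 Y, h3 X + h3 Y)%C.
Definition HCs (c : C) (X : HC) : HC := (c * h0 X, c * h1 X, c * h2 X, c * h3 X)%C.
Definition HCone : HC := (RtoC 1, RtoC 0, RtoC 0, RtoC 0).

Lemma HCmulE (X Y : HC) : HCmul X Y =
  (h0 X * h0 Y - h1 X * h1 Y - h2 X * h2 Y - h3 X * h3 Y,
   h0 X * h1 Y + h1 X * h0 Y + h2 X * h3 Y - h3 X * h2 Y,
   h0 X * h2 Y - h1 X * h3 Y + h2 X * h0 Y + h3 X * h1 Y,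
   h0 X * h3 Y + h1 X * h2 Y - h2 X * h1 Y + h3 X * h0 Y)%C.
Proof.
destruct X as [[[[] []] []] []]; destruct Y as [[[[] []] []] []].
unfold h0, h1, h2, h3, Cminus, Cplus, Copp, Cmult; cbn.
repeat match goal with |- (_, _) = (_, _) => apply f_equal2 end; ring.
Qed.

Lemma HC_comp (X Y : HC) :
  h0 X = h0 Y -> h1 X = h1 Y -> h2 X = h2 Y -> h3 X = h3 Y -> X = Y.
Proof.
destruct X as [[[? ?] ?] ?]; destruct Y as [[[? ?] ?] ?]; unfold h0, h1, h2, h3; cbn.
now intros -> -> -> ->.
Qed.

(* identities of the algebra, checked on the four complex coordinates *)
Ltac hring := apply HC_comp; repeat rewrite HCmulE; unfold HCadd, HCs, HCone, h0, h1, h2, h3;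
  cbn [fst snd]; ring.

Lemma HCmul_assoc X Y Z : HCmul X (HCmul Y Z) = HCmul (HCmul X Y) Z. Proof. hring. Qed.
Lemma HCmul_add_l X Y Z : HCmul (HCadd X Y) Z = HCadd (HCmul X Z) (HCmul Y Z). Proof. hring. Qed.
Lemma HCs_mul_l c X Y : HCmul (HCs c X) Y = HCs c (HCmul X Y). Proof. hring. Qed.
Lemma HCs_mul_r c X Y : HCmul X (HCs c Y) = HCs c (HCmul X Y). Proof. hring. Qed.
Lemma HCs_HCs c d X : HCs c (HCs d X) = HCs (c * d) X. Proof. hring. Qed.
Lemma HCs_plus c d X : HCs (c + d) X = HCadd (HCs c X) (HCs d X). Proof. hring. Qed.
Lemma HCs_1 X : HCs 1 X = X. Proof. hring. Qed.
Lemma HCmul_1_l X : HCmul HCone X = X. Proof. hring. Qed.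
Lemma HCmul_1_r X : HCmul X HCone = X. Proof. hring. Qed.
Lemma HCadd_assoc X Y Z : HCadd X (HCadd Y Z) = HCadd (HCadd X Y) Z. Proof. hring. Qed.

Lemma HCs_inj (c : C) X Y : c <> 0 -> HCs c X = HCs c Y -> X = Y.
Proof.
intros N E; rewrite <- (HCs_1 X), <- (HCs_1 Y).
replace (RtoC 1) with (/ c * c)%C by (field; exact N).
now rewrite <- !HCs_HCs, E.
Qed.

Fixpoint hsum (u : nat -> HC) (n : nat) : HC :=
  match n with O => u O | S m => HCadd (hsum u m) (u (S m)) end.

Lemma hsum_ext u v n : (forall k, (k <= n)%nat -> u k = v k) -> hsum u n = hsum v n.
Proof.
induction n as [| n IH]; intros E; cbn; [now apply E |].
rewrite IH, E; [easy | lia | intros; apply E; lia].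
Qed.

Lemma hsum_add u v n : hsum (fun k => HCadd (u k) (v k)) n = HCadd (hsum u n) (hsum v n).
Proof. induction n as [| n IH]; cbn; [easy |]; rewrite IH; hring. Qed.

Lemma hsum_mul_l X u n : hsum (fun k => HCmul X (u k)) n = HCmul X (hsum u n).
Proof. induction n as [| n IH]; cbn; [easy |]; rewrite IH; hring. Qed.

Lemma hsum_s c u n : hsum (fun k => HCs c (u k)) n = HCs c (hsum u n).
Proof. induction n as [| n IH]; cbn; [easy |]; rewrite IH; hring. Qed.

Lemma hsum_shift u n : hsum u (S n) = HCadd (u O) (hsum (fun k => u (S k)) n).
Proof. induction n as [| n IH]; [easy |]; cbn [hsum] in *; rewrite IH, HCadd_assoc; easy. Qed.

Fixpoint hpow (X : HC) (n : nat) : HC :=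
  match n with O => HCone | S m => HCmul X (hpow X m) end.

Definition hterm (X : HC) (n : nat) : HC := HCs (RtoC (/ INR (fact n))) (hpow X n).

Lemma hterm_0 X : hterm X 0 = HCone.
Proof. unfold hterm; cbn [fact INR hpow]; rewrite Rinv_1; apply HCs_1. Qed.

Lemma hterm_S X n : HCs (RtoC (INR (S n))) (hterm X (S n)) = HCmul X (hterm X n).
Proof.
unfold hterm; cbn [hpow]; rewrite HCs_HCs, HCs_mul_r; f_equal.
rewrite fact_simpl, mult_INR, <- RtoC_mult; f_equal; field.
split; [apply INR_fact_neq_0 | now apply not_0_INR].
Qed.

Lemma hpow_comm X Y n : HCmul X Y = HCmul Y X -> HCmul (hpow X n) Y = HCmul Y (hpow X n).
Proof.
intros XY; induction n as [| n IH]; cbn; [now rewrite HCmul_1_l, HCmul_1_r |].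
now rewrite <- HCmul_assoc, IH, HCmul_assoc, XY, HCmul_assoc.
Qed.

Lemma hterm_comm X Y n : HCmul X Y = HCmul Y X -> HCmul (hterm X n) Y = HCmul Y (hterm X n).
Proof. intros XY; unfold hterm; now rewrite HCs_mul_l, HCs_mul_r, hpow_comm. Qed.

Definition hconv (u v : nat -> HC) (n : nat) : HC := hsum (fun k => HCmul (u k) (v (n - k)%nat)) n.

(** The binomial formula divided by n!.  Multiplying the right-hand side at n + 1 by
    n + 1 = k + (n + 1 - k) and using k X^k / k! = X X^(k-1) / (k-1)! turns it into
    (X + Y) times the right-hand side at n. *)
Lemma hterm_add X Y n : HCmul X Y = HCmul Y X ->
  hterm (HCadd X Y) n = hconv (hterm X) (hterm Y) n.
Proof.
intros XY; induction n as [| n IH].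
{ unfold hconv; cbn [hsum Nat.sub]; now rewrite !hterm_0, HCmul_1_l. }
assert (N : RtoC (INR (S n)) <> 0).
{ intros E; apply RtoC_inj in E; revert E; now apply not_0_INR. }
apply (HCs_inj _ _ _ N); rewrite hterm_S, IH; unfold hconv.
rewrite HCmul_add_l, <- !hsum_mul_l.
rewrite <- hsum_s.
transitivity (HCadd
  (hsum (fun k => HCs (RtoC (INR k)) (HCmul (hterm X k) (hterm Y (S n - k)%nat))) (S n))
  (hsum (fun k => HCs (RtoC (INR (S n - k))) (HCmul (hterm X k) (hterm Y (S n - k)%nat))) (S n))).
- f_equal.
  + rewrite hsum_shift.
    replace (HCs (RtoC (INR 0)) _) with (HCs 0 HCone) by (cbn [INR]; hring).
    assert (Z0 : forall Z, HCadd (HCs 0 HCone) Z = Z) by (intros; hring).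
    rewrite Z0; apply hsum_ext; intros k Hk.
    now rewrite HCmul_assoc, <- hterm_S, HCs_mul_l.
  + cbn [hsum]; rewrite Nat.sub_diag.
    assert (Z0 : forall Z W, HCadd W (HCs (RtoC (INR 0)) Z) = W) by (intros; cbn [INR]; hring).
    rewrite Z0; apply hsum_ext; intros k Hk.
    rewrite HCmul_assoc, <- (hterm_comm X Y k XY), <- HCmul_assoc.
    replace (S n - k)%nat with (S (n - k)) by lia.
    now rewrite <- hterm_S, HCs_mul_r.
- rewrite <- hsum_add; apply hsum_ext; intros k Hk.
  rewrite <- HCs_plus, <- RtoC_plus, <- plus_INR; do 3 f_equal; lia.
Qed.

Definition cseries (u : nat -> C) (s : C) : Prop :=
  is_series (fun n => Re (u n)) (Re s) /\ is_series (fun n => Im (u n)) (Im s).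

Definition cabs (u : nat -> C) : Prop :=
  ex_series (fun n => Rabs (Re (u n))) /\ ex_series (fun n => Rabs (Im (u n))).

Fixpoint csum (u : nat -> C) (n : nat) : C :=
  match n with O => u O | S m => (csum u m + u (S m))%C end.

Definition cconv (u v : nat -> C) (n : nat) : C := csum (fun k => u k * v (n - k)%nat)%C n.

Lemma cseries_unique u s t : cseries u s -> cseries u t -> s = t.
Proof.
intros [A1 A2] [B1 B2]; apply is_series_unique in A1, A2, B1, B2.
destruct s, t; unfold Re, Im in *; cbn in *; congruence.
Qed.

Lemma cseries_plus u v s t : cseries u s -> cseries v t ->
  cseries (fun n => u n + v n)%C (s + t)%C.
Proof.
intros [A1 A2] [B1 B2]; split; [exact (is_series_plus _ _ _ _ A1 B1) |
  exact (is_series_plus _ _ _ _ A2 B2)].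
Qed.

Lemma cseries_opp u s : cseries u s -> cseries (fun n => - u n)%C (- s)%C.
Proof. intros [A1 A2]; split; [exact (is_series_opp _ _ A1) | exact (is_series_opp _ _ A2)]. Qed.

Lemma cseries_minus u v s t : cseries u s -> cseries v t ->
  cseries (fun n => u n - v n)%C (s - t)%C.
Proof. intros A B; apply cseries_plus; [exact A | now apply cseries_opp]. Qed.

Lemma csum_Re u n : Re (csum u n) = sum_f_R0 (fun k => Re (u k)) n.
Proof. induction n as [| n IH]; cbn; [easy | now rewrite <- IH]. Qed.
Lemma csum_Im u n : Im (csum u n) = sum_f_R0 (fun k => Im (u k)) n.
Proof. induction n as [| n IH]; cbn; [easy | now rewrite <- IH]. Qed.

Lemma cseries_mult u v s t : cseries u s -> cseries v t -> cabs u -> cabs v ->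
  cseries (cconv u v) (s * t)%C.
Proof.
intros [U1 U2] [V1 V2] [A1 A2] [B1 B2]; unfold cconv; split.
- apply (is_series_ext (fun n => plus
    (sum_f_R0 (fun k => Re (u k) * Re (v (n - k)%nat)) n)
    (opp (sum_f_R0 (fun k => Im (u k) * Im (v (n - k)%nat)) n)))).
  + intros n; rewrite csum_Re.
    unfold plus, opp; cbn -[sum_f_R0]; rewrite <- Rminus_def, <- minus_sum; now apply sum_eq.
  + exact (is_series_plus _ _ _ _ (is_series_mult _ _ _ _ U1 V1 A1 B1)
      (is_series_opp _ _ (is_series_mult _ _ _ _ U2 V2 A2 B2))).
- apply (is_series_ext (fun n => plus
    (sum_f_R0 (fun k => Re (u k) * Im (v (n - k)%nat)) n)
    (sum_f_R0 (fun k => Im (u k) * Re (v (n - k)%nat)) n))).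
  + intros n; rewrite csum_Im.
    unfold plus; cbn -[sum_f_R0]; rewrite <- plus_sum; now apply sum_eq.
  + exact (is_series_plus _ _ _ _ (is_series_mult _ _ _ _ U1 V2 A1 B2)
      (is_series_mult _ _ _ _ U2 V1 A2 B1)).
Qed.

Definition hseries (u : nat -> HC) (s : HC) : Prop :=
  cseries (fun n => h0 (u n)) (h0 s) /\ cseries (fun n => h1 (u n)) (h1 s) /\
  cseries (fun n => h2 (u n)) (h2 s) /\ cseries (fun n => h3 (u n)) (h3 s).

Definition habs (u : nat -> HC) : Prop :=
  cabs (fun n => h0 (u n)) /\ cabs (fun n => h1 (u n)) /\
  cabs (fun n => h2 (u n)) /\ cabs (fun n => h3 (u n)).

Lemma hseries_unique u s t : hseries u s -> hseries u t -> s = t.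
Proof.
intros (A0 & A1 & A2 & A3) (B0 & B1 & B2 & B3).
apply HC_comp; eapply cseries_unique; eassumption.
Qed.

Lemma hseries_ext u v s : (forall n, u n = v n) -> hseries u s -> hseries v s.
Proof.
intros E (A0 & A1 & A2 & A3); repeat split;
  (eapply is_series_ext; [intros n; rewrite <- E; reflexivity |]); apply A0 || apply A1 || apply A2 || apply A3.
Qed.

Lemma hsum_conv u v n : hconv u v n =
  (cconv (fun k => h0 (u k)) (fun k => h0 (v k)) n - cconv (fun k => h1 (u k)) (fun k => h1 (v k)) n
   - cconv (fun k => h2 (u k)) (fun k => h2 (v k)) n - cconv (fun k => h3 (u k)) (fun k => h3 (v k)) n,
   cconv (fun k => h0 (u k)) (fun k => h1 (v k)) n + cconv (fun k => h1 (u k)) (fun k => h0 (v k)) n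
   + cconv (fun k => h2 (u k)) (fun k => h3 (v k)) n - cconv (fun k => h3 (u k)) (fun k => h2 (v k)) n,
   cconv (fun k => h0 (u k)) (fun k => h2 (v k)) n - cconv (fun k => h1 (u k)) (fun k => h3 (v k)) n
   + cconv (fun k => h2 (u k)) (fun k => h0 (v k)) n + cconv (fun k => h3 (u k)) (fun k => h1 (v k)) n,
   cconv (fun k => h0 (u k)) (fun k => h3 (v k)) n + cconv (fun k => h1 (u k)) (fun k => h2 (v k)) n
   - cconv (fun k => h2 (u k)) (fun k => h1 (v k)) n + cconv (fun k => h3 (u k)) (fun k => h0 (v k)) n)%C.
Proof.
unfold hconv, cconv.
assert (G : forall w : nat -> nat, forall m,
  hsum (fun k => HCmul (u k) (v (w k))) m =
  let c a b := csum (fun k => a (u k) * b (v (w k)))%C m in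
  (c h0 h0 - c h1 h1 - c h2 h2 - c h3 h3, c h0 h1 + c h1 h0 + c h2 h3 - c h3 h2,
   c h0 h2 - c h1 h3 + c h2 h0 + c h3 h1, c h0 h3 + c h1 h2 - c h2 h1 + c h3 h0)%C).
{ intros w m; induction m as [| m IH]; cbn [hsum csum]; cbv zeta in *; [apply HCmulE |].
  rewrite IH; hring. }
apply (G (fun k => n - k)%nat n).
Qed.

Ltac cseries_split := lazymatch goal with
  | |- cseries (fun n => Cminus (@?a n) (@?b n)) (Cminus ?s ?t) =>
      apply (cseries_minus a b s t); cseries_split
  | |- cseries (fun n => Cplus (@?a n) (@?b n)) (Cplus ?s ?t) =>
      apply (cseries_plus a b s t); cseries_split
  | _ => idtac end.

Lemma hseries_mul u v s t : hseries u s -> hseries v t -> habs u -> habs v ->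
  hseries (hconv u v) (HCmul s t).
Proof.
intros (U0 & U1 & U2 & U3) (V0 & V1 & V2 & V3) (A0 & A1 & A2 & A3) (B0 & B1 & B2 & B3).
rewrite HCmulE.
eapply hseries_ext; [intros n; symmetry; apply hsum_conv |].
unfold hseries, h0, h1, h2, h3 in *; cbn [fst snd].
split; [| split; [| split]]; cseries_split; now apply cseries_mult.
Qed.

Definition hnorm (X : HC) : R := Cmod (h0 X) + Cmod (h1 X) + Cmod (h2 X) + Cmod (h3 X).

Lemma hnorm_mul X Y : hnorm (HCmul X Y) <= hnorm X * hnorm Y.
Proof.
rewrite HCmulE; destruct X as [[[a b] c] d]; destruct Y as [[[p q] r] s].
unfold hnorm, h0, h1, h2, h3, Cminus; cbn [fst snd].
assert (T : forall t u v w : C, Cmod (t + u + v + w) <= Cmod t + Cmod u + Cmod v + Cmod w).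
{ intros t u v w.
  pose proof (Cmod_triangle (t + u + v)%C w); pose proof (Cmod_triangle (t + u)%C v);
  pose proof (Cmod_triangle t u); lra. }
pose proof (T (a * p) (- (b * q)) (- (c * r)) (- (d * s)))%C as T0.
pose proof (T (a * q) (b * p) (c * s) (- (d * r)))%C as T1.
pose proof (T (a * r) (- (b * s)) (c * p) (d * q))%C as T2.
pose proof (T (a * s) (b * r) (- (c * q)) (d * p))%C as T3.
repeat rewrite Cmod_opp in *; repeat rewrite Cmod_mult in *.
lra.
Qed.

Lemma hnorm_pow X n : hnorm (hpow X n) <= hnorm X ^ n.
Proof.
induction n as [| n IH]; cbn [hpow pow].
- unfold hnorm, HCone, h0, h1, h2, h3; cbn [fst snd]; rewrite Cmod_1, Cmod_0; lra.
- eapply Rle_trans; [apply hnorm_mul |]; apply Rmult_le_compat_l; [| exact IH].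
  unfold hnorm; pose proof (Cmod_ge_0 (h0 X)); pose proof (Cmod_ge_0 (h1 X));
  pose proof (Cmod_ge_0 (h2 X)); pose proof (Cmod_ge_0 (h3 X)); lra.
Qed.

(** The sum of the moduli of the coordinates is submultiplicative, so the terms are
    dominated by those of the real exponential series. *)
Lemma hterm_abs X : habs (hterm X).
Proof.
assert (B : forall l : HC -> C, (forall Y, Cmod (l Y) <= hnorm Y) ->
  (forall c Y, l (HCs c Y) = (c * l Y)%C) -> cabs (fun n => l (hterm X n))).
{ intros l Hl Hs.
  assert (D : forall n, Cmod (l (hterm X n)) <= / INR (fact n) * hnorm X ^ n).
  { intros n; unfold hterm; rewrite Hs, Cmod_mult, Cmod_R.
    assert (P : 0 < / INR (fact n)) by apply Rinv_0_lt_compat, INR_fact_lt_0.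
    rewrite Rabs_right by lra; apply Rmult_le_compat_l; [lra |].
    eapply Rle_trans; [apply Hl | apply hnorm_pow]. }
  assert (E : ex_series (fun n => / INR (fact n) * hnorm X ^ n)).
  { exists (exp (hnorm X)); eapply is_series_ext; [| apply (is_exp_Reals (hnorm X))].
    intros n; unfold scal; cbn; unfold mult; cbn; rewrite pow_n_pow; ring. }
  split; apply (ex_series_le (K := R_AbsRing) (V := R_CompleteNormedModule) _ _) with (2 := E);
    intros n; unfold norm; cbn; unfold abs; cbn; rewrite Rabs_Rabsolu;
    (eapply Rle_trans; [| apply D]); [apply Re_le_Cmod | apply Im_le_Cmod]. }
repeat match goal with |- habs _ => split | |- _ /\ _ => split end;
  try (apply B; [| reflexivity]; intros Y; unfold hnorm;
    pose proof (Cmod_ge_0 (h0 Y)); pose proof (Cmod_ge_0 (h1 Y));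
    pose proof (Cmod_ge_0 (h2 Y)); pose proof (Cmod_ge_0 (h3 Y)); lra).
Qed.

Definition cser (u : nat -> C) : C := (Series (fun n => Re (u n)), Series (fun n => Im (u n))).

Definition HCexp (X : HC) : HC :=
  (cser (fun n => h0 (hterm X n)), cser (fun n => h1 (hterm X n)),
   cser (fun n => h2 (hterm X n)), cser (fun n => h3 (hterm X n))).

Lemma cabs_series u : cabs u -> cseries u (cser u).
Proof. intros [A B]; split; apply Series_correct; now apply ex_series_Rabs. Qed.

Lemma HCexp_series X : hseries (hterm X) (HCexp X).
Proof.
destruct (hterm_abs X) as (A0 & A1 & A2 & A3).
repeat match goal with |- hseries _ _ => split | |- _ /\ _ => split end;
  now apply cabs_series.
Qed.

(** Cauchy product of absolutely convergent series. *)
Lemma HCexp_add X Y : HCmul X Y = HCmul Y X -> HCexp (HCadd X Y) = HCmul (HCexp X) (HCexp Y).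
Proof.
intros XY; apply (hseries_unique (hterm (HCadd X Y))); [apply HCexp_series |].
apply (hseries_ext (hconv (hterm X) (hterm Y))).
- intros n; symmetry; now apply hterm_add.
- apply hseries_mul; apply HCexp_series || apply hterm_abs.
Qed.

(** * Exponentials of vectors *)

(** The entire function sin r / r, read off the power series that defines the sine, so
    that r = 0 is not a special case. *)
Definition sinc (r : R) : R := let (a, _) := exist_sin (Rsqr r) in a.

Lemma sin_sinc r : sin r = r * sinc r.
Proof. unfold sin, sinc; now destruct (exist_sin (Rsqr r)). Qed.

Lemma trig_series (t : nat -> R) r p q :
  (forall k, t (2 * k)%nat = cos_n k * Rsqr r ^ k * p) ->
  (forall k, t (2 * k + 1)%nat = sin_n k * Rsqr r ^ k * q) ->
  is_series t (cos r * p + sinc r * q).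
Proof.
intros E O.
assert (Cs : is_series (fun k => cos_n k * Rsqr r ^ k) (cos r)).
{ apply is_series_Reals; unfold cos; destruct (exist_cos (Rsqr r)) as [l Hl]; exact Hl. }
assert (Ss : is_series (fun k => sin_n k * Rsqr r ^ k) (sinc r)).
{ apply is_series_Reals; unfold sinc; destruct (exist_sin (Rsqr r)) as [l Hl]; exact Hl. }
assert (one : forall (u : nat -> R) l, is_series u l -> is_pseries u (1 ^ 2) l).
{ intros u l; apply is_series_ext; intros n; unfold scal; cbn; unfold mult; cbn.
  rewrite pow_n_pow, !Rmult_1_r, pow1; ring. }
assert (P := is_pseries_odd_even t 1 (p * cos r) (q * sinc r)).
lapply P; [clear P; intros P | apply one].
- lapply P; [clear P; intros P | apply one].
  + replace (cos r * p + sinc r * q) with (p * cos r + 1 * (q * sinc r)) by ring.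
    revert P; apply is_series_ext; intros n; unfold scal; cbn; unfold mult; cbn.
    rewrite pow_n_pow, pow1; ring.
  + eapply is_series_ext; [| exact (is_series_scal q _ _ Ss)].
    intros k; rewrite O; unfold scal; cbn; unfold mult; cbn; ring.
- eapply is_series_ext; [| exact (is_series_scal p _ _ Cs)].
  intros k; rewrite E; unfold scal; cbn; unfold mult; cbn; ring.
Qed.

(** The even powers of V are the scalars (- r^2)^k and the odd ones (- r^2)^k V. *)
Lemma HCexp_trig V r : HCmul V V = HCs (RtoC (- Rsqr r)) HCone ->
  HCexp V = HCadd (HCs (RtoC (cos r)) HCone) (HCs (RtoC (sinc r)) V).
Proof.
intros VV.
assert (Pe : forall k, hpow V (2 * k) = HCs (RtoC ((- Rsqr r) ^ k)) HCone).
{ induction k as [| k IH]; [cbn; now rewrite HCs_1 |].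
  replace (2 * S k)%nat with (S (S (2 * k))) by lia; cbn [hpow pow].
  rewrite HCmul_assoc, VV, IH, HCs_mul_l, HCmul_1_l, HCs_HCs, <- RtoC_mult; easy. }
assert (sgn : forall k, (- Rsqr r) ^ k = (-1) ^ k * Rsqr r ^ k).
{ intros k; rewrite <- Rpow_mult_distr; f_equal; ring. }
assert (Te : forall k, hterm V (2 * k) = HCs (RtoC (cos_n k * Rsqr r ^ k)) HCone).
{ intros k; unfold hterm; rewrite Pe, HCs_HCs, <- RtoC_mult, sgn; unfold cos_n.
  f_equal; f_equal; field; apply INR_fact_neq_0. }
assert (To : forall k, hterm V (2 * k + 1) = HCs (RtoC (sin_n k * Rsqr r ^ k)) V).
{ intros k; unfold hterm, sin_n.
  replace (2 * k + 1)%nat with (S (2 * k)) by lia; cbn [hpow].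
  rewrite Pe, HCs_mul_r, HCmul_1_r, HCs_HCs, <- RtoC_mult, sgn.
  f_equal; f_equal; field; apply INR_fact_neq_0. }
apply (hseries_unique (hterm V)); [apply HCexp_series |].
assert (G : forall l : HC -> R,
  (forall a X, l (HCs (RtoC a) X) = a * l X) -> (forall X Y, l (HCadd X Y) = l X + l Y) ->
  is_series (fun n => l (hterm V n))
    (l (HCadd (HCs (RtoC (cos r)) HCone) (HCs (RtoC (sinc r)) V)))).
{ intros l Ls La; rewrite La, !Ls; apply trig_series; intros k.
  - now rewrite Te, Ls.
  - now rewrite To, Ls. }
assert (RE : forall a z, Re (RtoC a * z) = a * Re z) by (intros a []; unfold Re; cbn; ring).
assert (IM : forall a z, Im (RtoC a * z) = a * Im z) by (intros a []; unfold Im; cbn; ring).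
repeat match goal with |- hseries _ _ => split | |- _ /\ _ => split
  | |- cseries _ _ => split end.
- apply (G (fun X => Re (h0 X))); [intros; apply RE | easy].
- apply (G (fun X => Im (h0 X))); [intros; apply IM | easy].
- apply (G (fun X => Re (h1 X))); [intros; apply RE | easy].
- apply (G (fun X => Im (h1 X))); [intros; apply IM | easy].
- apply (G (fun X => Re (h2 X))); [intros; apply RE | easy].
- apply (G (fun X => Im (h2 X))); [intros; apply IM | easy].
- apply (G (fun X => Re (h3 X))); [intros; apply RE | easy].
- apply (G (fun X => Im (h3 X))); [intros; apply IM | easy].
Qed.

Lemma HCexp_0 : HCexp (HCs 0 HCone) = HCone.
Proof.
rewrite (HCexp_trig _ 0).
- rewrite cos_0; hring.
- rewrite Rsqr_0, Ropp_0; hring.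
Qed.

(** Nonzero because exp c exp (- c) = 1. *)
Lemma HCexp_scalar c : exists s : C, s <> 0 /\ HCexp (HCs c HCone) = HCs s HCone.
Proof.
assert (S : forall c, exists s, HCexp (HCs c HCone) = HCs s HCone).
{ clear c; intros c; exists (h0 (HCexp (HCs c HCone))).
  assert (P : forall n, exists d, hterm (HCs c HCone) n = HCs d HCone).
  { intros n; assert (Q : exists d, hpow (HCs c HCone) n = HCs d HCone).
    { induction n as [| n [d IH]]; [exists (RtoC 1); cbn; now rewrite HCs_1 |].
      exists (c * d)%C; cbn; rewrite IH; hring. }
    destruct Q as [d Q]; unfold hterm; rewrite Q, HCs_HCs; now eexists. }
  assert (Z : forall l : HC -> C, (forall d, l (HCs d HCone) = 0) ->
    cser (fun n => l (hterm (HCs c HCone) n)) = 0).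
  { intros l Hl; unfold cser.
    rewrite (Series_ext _ (fun _ => 0)), (Series_ext (fun n => Im _) (fun _ => 0)).
    - assert (Z0 : Series (fun _ => 0) = 0).
      { transitivity (Series (fun _ => 0 * 0)); [apply Series_ext; intros; ring |].
        rewrite Series_scal_l; ring. }
      now rewrite Z0.
    - intros n; destruct (P n) as [d ->]; now rewrite Hl.
    - intros n; destruct (P n) as [d ->]; now rewrite Hl. }
  apply HC_comp.
  - unfold HCs, HCone; cbn [h0 fst snd]; unfold h0; cbn [fst snd]; ring.
  - unfold HCexp, h1 at 1; cbn [fst snd]; rewrite (Z h1); unfold HCs, HCone, h1; cbn [fst snd]; intros; ring.
  - unfold HCexp, h2 at 1; cbn [fst snd]; rewrite (Z h2); unfold HCs, HCone, h2; cbn [fst snd]; intros; ring.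
  - unfold HCexp, h3 at 1; cbn [fst snd]; rewrite (Z h3); unfold HCs, HCone, h3; cbn [fst snd]; intros; ring. }
destruct (S c) as [s Hs], (S (- c)%C) as [t Ht].
exists s; split; [| exact Hs]; intros ->.
assert (E : HCexp (HCadd (HCs c HCone) (HCs (- c) HCone)) = HCone).
{ rewrite <- HCexp_0; f_equal; hring. }
rewrite HCexp_add, Hs in E by hring.
apply (f_equal h0) in E; rewrite HCmulE in E.
unfold HCs, HCone, h0, h1, h2, h3 in E; cbn [fst snd] in E.
rewrite !Cmult_0_l in E; apply (f_equal Re) in E; unfold Re in E; cbn in E; lra.
Qed.

Definition hvec (X : HC) : HC := (RtoC 0, h1 X, h2 X, h3 X).

Lemma hvec_decomp X : X = HCadd (HCs (h0 X) HCone) (hvec X).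
Proof. unfold hvec; hring. Qed.

(** The scalar parts are central and contribute the same invertible factor to both
    sides. *)
Lemma HCexp_vec X Y :
  HCexp (HCadd X Y) = HCmul (HCexp X) (HCexp Y) <->
  HCexp (HCadd (hvec X) (hvec Y)) = HCmul (HCexp (hvec X)) (HCexp (hvec Y)).
Proof.
assert (D : forall Z, exists s : C, s <> 0 /\ HCexp (HCs (h0 Z) HCone) = HCs s HCone /\
  HCexp Z = HCs s (HCexp (hvec Z))).
{ intros Z; destruct (HCexp_scalar (h0 Z)) as (s & s0 & Hs).
  exists s; split; [exact s0 | split; [exact Hs |]].
  rewrite (hvec_decomp Z) at 1; rewrite HCexp_add by hring.
  now rewrite Hs, HCs_mul_l, HCmul_1_l. }
destruct (D X) as (s & s0 & Es & Ex), (D Y) as (t & t0 & Et & Ey).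
assert (E : HCexp (HCadd X Y) = HCs (s * t) (HCexp (HCadd (hvec X) (hvec Y)))).
{ replace (HCadd X Y) with
    (HCadd (HCadd (HCs (h0 X) HCone) (HCs (h0 Y) HCone)) (HCadd (hvec X) (hvec Y)))
    by (unfold hvec; hring).
  rewrite HCexp_add, HCexp_add, Es, Et by hring.
  now rewrite !HCs_mul_l, !HCmul_1_l, HCs_mul_l, HCmul_1_l, HCs_HCs. }
rewrite E, Ex, Ey, HCs_mul_l, HCs_mul_r, HCs_HCs.
split; [apply HCs_inj; now apply Cmult_neq_0 | now intros ->].
Qed.

Definition rvec (a b c : R) : HC := (RtoC 0, RtoC a, RtoC b, RtoC c).
Definition rlen (a b c : R) : R := sqrt (a * a + b * b + c * c).

Lemma rlen_sqr a b c : Rsqr (rlen a b c) = a * a + b * b + c * c.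
Proof.
apply Rsqr_sqrt.
pose proof (Rle_0_sqr a); pose proof (Rle_0_sqr b); pose proof (Rle_0_sqr c).
unfold Rsqr in *; lra.
Qed.

Lemma rlen_pos a b c : a <> 0 \/ b <> 0 \/ c <> 0 -> 0 < rlen a b c.
Proof.
intros N; apply sqrt_lt_R0.
pose proof (Rle_0_sqr a); pose proof (Rle_0_sqr b); pose proof (Rle_0_sqr c).
destruct N as [N | [N | N]]; apply Rsqr_pos_lt in N; unfold Rsqr in *; lra.
Qed.

Lemma HCexp_rvec a b c : HCexp (rvec a b c) =
  HCadd (HCs (RtoC (cos (rlen a b c))) HCone) (HCs (RtoC (sinc (rlen a b c))) (rvec a b c)).
Proof.
apply HCexp_trig; rewrite rlen_sqr; unfold rvec.
rewrite RtoC_opp, !RtoC_plus, !RtoC_mult; hring.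
Qed.

(** Write p = a + b.  As n = a x b is nonzero, a, b and n form a basis of R^3.  The component of the equation
    along n gives sinc |a| sinc |b| = 0, those along a and b then give
    sinc |p| = sinc |a| cos |b| = cos |a| sinc |b|; as a zero of the sine is not a zero
    of the cosine, all three vanish. *)
Lemma noncommuting_exp a1 a2 a3 b1 b2 b3 :
  HCexp (HCadd (rvec a1 a2 a3) (rvec b1 b2 b3))
    = HCmul (HCexp (rvec a1 a2 a3)) (HCexp (rvec b1 b2 b3)) ->
  a2 * b3 - a3 * b2 <> 0 \/ a3 * b1 - a1 * b3 <> 0 \/ a1 * b2 - a2 * b1 <> 0 ->
  let a := rlen a1 a2 a3 in let b := rlen b1 b2 b3 in
  let p := rlen (a1 + b1) (a2 + b2) (a3 + b3) in
  sin a = 0 /\ sin b = 0 /\ sin p = 0 /\ cos p = cos a * cos b /\ 0 < a /\ 0 < b /\ 0 < p.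
Proof.
intros E N a b p.
replace (HCadd (rvec a1 a2 a3) (rvec b1 b2 b3)) with (rvec (a1 + b1) (a2 + b2) (a3 + b3)) in E
  by (unfold rvec; rewrite !RtoC_plus; hring).
rewrite !HCexp_rvec in E; fold a b p in E.
assert (F0 := f_equal (fun X => Re (h0 X)) E).
assert (F1 := f_equal (fun X => Re (h1 X)) E).
assert (F2 := f_equal (fun X => Re (h2 X)) E).
assert (F3 := f_equal (fun X => Re (h3 X)) E).
rewrite HCmulE in F0, F1, F2, F3.
unfold HCadd, HCs, HCone, rvec, h0, h1, h2, h3, Re in F0, F1, F2, F3; cbn in F0, F1, F2, F3.
assert (A0 : 0 < a).
{ apply rlen_pos; apply NNPP; intros M.
  assert (a1 = 0) by (apply NNPP; tauto); assert (a2 = 0) by (apply NNPP; tauto).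
  assert (a3 = 0) by (apply NNPP; tauto); subst; lra. }
assert (B0 : 0 < b).
{ apply rlen_pos; apply NNPP; intros M.
  assert (b1 = 0) by (apply NNPP; tauto); assert (b2 = 0) by (apply NNPP; tauto).
  assert (b3 = 0) by (apply NNPP; tauto); subst; lra. }
assert (P0 : 0 < p).
{ apply rlen_pos; apply NNPP; intros M.
  assert (Z1 : b1 = - a1) by (enough (a1 + b1 = 0) by lra; apply NNPP; tauto).
  assert (Z2 : b2 = - a2) by (enough (a2 + b2 = 0) by lra; apply NNPP; tauto).
  assert (Z3 : b3 = - a3) by (enough (a3 + b3 = 0) by lra; apply NNPP; tauto).
  subst; lra. }
rewrite !sin_sinc.
set (sa := sinc a) in *; set (sb := sinc b) in *; set (sp := sinc p) in *.
set (n1 := a2 * b3 - a3 * b2) in *; set (n2 := a3 * b1 - a1 * b3) in *;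
set (n3 := a1 * b2 - a2 * b1) in *.
assert (G0 : cos p = cos a * cos b - sa * sb * (a1 * b1 + a2 * b2 + a3 * b3)) by lra.
assert (G1 : sp * (a1 + b1) = sa * cos b * a1 + cos a * sb * b1 + sa * sb * n1)
  by (unfold n1; lra).
assert (G2 : sp * (a2 + b2) = sa * cos b * a2 + cos a * sb * b2 + sa * sb * n2)
  by (unfold n2; lra).
assert (G3 : sp * (a3 + b3) = sa * cos b * a3 + cos a * sb * b3 + sa * sb * n3)
  by (unfold n3; lra).
clear F0 F1 F2 F3 E.
assert (NN : n1 * n1 + n2 * n2 + n3 * n3 <> 0).
{ pose proof (Rle_0_sqr n1); pose proof (Rle_0_sqr n2); pose proof (Rle_0_sqr n3).
  destruct N as [N | [N | N]]; apply Rsqr_pos_lt in N; unfold Rsqr in *; lra. }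
assert (S : sa * sb = 0).
{ apply (Rmult_eq_reg_r _ _ _) with (2 := NN).
  transitivity (n1 * (sa * sb * n1) + n2 * (sa * sb * n2) + n3 * (sa * sb * n3)); [ring |].
  replace (sa * sb * n1) with (sp * (a1 + b1) - (sa * cos b * a1 + cos a * sb * b1)) by lra.
  replace (sa * sb * n2) with (sp * (a2 + b2) - (sa * cos b * a2 + cos a * sb * b2)) by lra.
  replace (sa * sb * n3) with (sp * (a3 + b3) - (sa * cos b * a3 + cos a * sb * b3)) by lra.
  unfold n1, n2, n3; ring. }
rewrite S in G0, G1, G2, G3.
assert (K : forall k l, k * n1 = l * n1 -> k * n2 = l * n2 -> k * n3 = l * n3 -> k = l).
{ intros k l K1 K2 K3; destruct N as [N | [N | N]];
    [exact (Rmult_eq_reg_r _ _ _ K1 N) | exact (Rmult_eq_reg_r _ _ _ K2 N)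
    | exact (Rmult_eq_reg_r _ _ _ K3 N)]. }
assert (U : sp = cos a * sb).
{ apply K; unfold n1, n2, n3.
  - transitivity (a2 * (sp * (a3 + b3)) - a3 * (sp * (a2 + b2))); [ring | rewrite G2, G3; ring].
  - transitivity (a3 * (sp * (a1 + b1)) - a1 * (sp * (a3 + b3))); [ring | rewrite G1, G3; ring].
  - transitivity (a1 * (sp * (a2 + b2)) - a2 * (sp * (a1 + b1))); [ring | rewrite G1, G2; ring]. }
assert (V : sp = sa * cos b).
{ apply K; unfold n1, n2, n3.
  - transitivity (- (b2 * (sp * (a3 + b3)) - b3 * (sp * (a2 + b2)))); [ring | rewrite G2, G3; ring].
  - transitivity (- (b3 * (sp * (a1 + b1)) - b1 * (sp * (a3 + b3)))); [ring | rewrite G1, G3; ring].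
  - transitivity (- (b1 * (sp * (a2 + b2)) - b2 * (sp * (a1 + b1)))); [ring | rewrite G1, G2; ring]. }
assert (T : sa = 0 /\ sb = 0 /\ sp = 0).
{ assert (cosn : forall x, sinc x = 0 -> cos x <> 0).
  { intros x Sx Cx; pose proof (sin2_cos2 x) as Q.
    rewrite sin_sinc, Sx, Cx in Q; unfold Rsqr in Q; lra. }
  apply Rmult_integral in S; destruct S as [S | S].
  - assert (Sp : sp = 0) by (rewrite V, S; ring).
    repeat split; [exact S | | exact Sp].
    rewrite Sp in U; symmetry in U; apply Rmult_integral in U.
    destruct U as [U | U]; [now apply cosn in S | exact U].
  - assert (Sp : sp = 0) by (rewrite U, S; ring).
    repeat split; [| exact S | exact Sp].
    rewrite Sp in V; symmetry in V; apply Rmult_integral in V.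
    destruct V as [V | V]; [exact V | now apply cosn in S]. }
destruct T as (T1 & T2 & T3); rewrite T1, T2, T3; repeat split; try ring; try assumption.
rewrite G0; ring.
Qed.

(** * Operations on slice functions, computed on stems *)

Lemma ex_derive_linear {V W : NormedModule C_AbsRing} (F : C -> V) (l : V -> W) (z : C) :
  is_linear l -> ex_derive (K := C_AbsRing) F z ->
  ex_derive (K := C_AbsRing) (fun w => l (F w)) z.
Proof.
intros Hl HF; apply ex_derive_filterdiff; apply ex_derive_filterdiff in HF.
apply (ex_filterdiff_comp' (U := AbsRing_NormedModule C_AbsRing) F l z HF); now apply ex_filterdiff_linear.
Qed.

Lemma ex_derive_cdiff (f : C -> C) (z : C) :
  ex_derive (K := C_AbsRing) (V := C_NormedModule) f z -> cdiff f z.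
Proof.
intros [l [_ Hl]].
specialize (Hl z (fun P H => H)).
exists (fun w => if excluded_middle_informative (w = z) then l else ((f w - f z) / (w - z))%C).
split.
- apply ccontE; intros eps He.
  assert (e2 : 0 < eps / 2) by lra.
  destruct (Hl (mkposreal _ e2)) as [d Hd].
  exists d; split; [apply cond_pos |]; intros w Hw.
  destruct (excluded_middle_informative (z = z)) as [_ |]; [| easy].
  destruct (excluded_middle_informative (w = z)) as [| N].
  { replace (l - l)%C with (RtoC 0) by ring; now rewrite Cmod_0. }
  specialize (Hd w Hw).
  change (Cmod (f w - f z - (w - z) * l) <= eps / 2 * Cmod (w - z)) in Hd.
  assert (P : 0 < Cmod (w - z)) by (apply Cmod_gt_0; now apply Cminus_neq).
  replace ((f w - f z) / (w - z) - l)%C with ((f w - f z - (w - z) * l) / (w - z))%C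
    by (field; now apply Cminus_neq).
  rewrite Cmod_div by now apply Cminus_neq.
  apply Rle_lt_trans with (eps / 2); [| lra].
  apply (Rmult_le_reg_r _ _ _ P).
  unfold Rdiv at 1; rewrite Rmult_assoc, Rinv_l by lra; lra.
- intros w; destruct excluded_middle_informative as [-> | N]; [ring |].
  field; now apply Cminus_neq.
Qed.

Lemma is_linear_h0 : is_linear (K := C_AbsRing) (V := C_NormedModule) h0.
Proof.
exact (is_linear_comp _ _ (is_linear_comp _ _ is_linear_fst is_linear_fst) is_linear_fst).
Qed.
Lemma is_linear_h1 : is_linear (K := C_AbsRing) (V := C_NormedModule) h1.
Proof.
exact (is_linear_comp _ _ (is_linear_comp _ _ is_linear_fst is_linear_fst) is_linear_snd).
Qed.
Lemma is_linear_h2 : is_linear (K := C_AbsRing) (V := C_NormedModule) h2.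
Proof. exact (is_linear_comp _ _ is_linear_fst is_linear_snd). Qed.
Lemma is_linear_h3 : is_linear (K := C_AbsRing) (V := C_NormedModule) h3.
Proof. exact is_linear_snd. Qed.

Definition HCsc (c : C) : HC := (c, RtoC 0, RtoC 0, RtoC 0).

Lemma is_linear_HCsc :
  is_linear (K := C_AbsRing) (U := C_NormedModule) HCsc.
Proof.
exact (is_linear_prod _ _ (is_linear_prod _ _ (is_linear_prod _ _ is_linear_id is_linear_zero)
  is_linear_zero) is_linear_zero).
Qed.

Lemma HCreE X : HCre X = (Re (h0 X), Re (h1 X), Re (h2 X), Re (h3 X)).
Proof. now destruct X as [[[? ?] ?] ?]. Qed.
Lemma HCimE X : HCim X = (Im (h0 X), Im (h1 X), Im (h2 X), Im (h3 X)).
Proof. now destruct X as [[[? ?] ?] ?]. Qed.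
Lemma HCbarE X : HCbar X = (Cconj (h0 X), Cconj (h1 X), Cconj (h2 X), Cconj (h3 X)).
Proof. now destruct X as [[[? ?] ?] ?]. Qed.
Lemma HCconjE X : HCconj X = (h0 X, - h1 X, - h2 X, - h3 X)%C.
Proof. now destruct X as [[[[] []] []] []]. Qed.

Lemma HCbar_mul X Y : HCbar (HCmul X Y) = HCmul (HCbar X) (HCbar Y).
Proof.
rewrite !HCbarE, !HCmulE; unfold h0, h1, h2, h3; cbn [fst snd].
repeat rewrite ?Cplus_conj, ?Cminus_conj, ?Cmult_conj; easy.
Qed.

(* identities that hold as polynomials in the real coordinates *)
Ltac hreal := repeat match goal with X : HC |- _ => destruct X as [[[[] []] []] []] end;
  repeat match goal with X : H |- _ => destruct X as [[[] ?] ?] end;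
  repeat rewrite HCmulE;
  rewrite ?HCreE, ?HCimE, ?HCbarE, ?HCconjE;
  unfold HCadd, HCs, HCone, HCsc, hvec, h0, h1, h2, h3, Cplus, Cmult, Cminus, Copp, Cconj, RtoC;
  Hunfold;
  repeat match goal with |- (_, _) = (_, _) => apply f_equal2 end; try field.

Section Stem.
Variable D : C -> Prop.
Hypothesis HD : conj_invariant D.

Definition has_stem (F : C -> HC) (f : H -> H) : Prop := stem_function D F /\ induces D F f.

Lemma has_stem_eq F G f g : has_stem F f -> has_stem G g ->
  (forall q, Omega D q -> f q = g q) <-> (forall z, D z -> F z = G z).
Proof.
intros [sF iF] [sG iG]; split.
- intros E; apply (stem_unique D F G g); try assumption.
  intros a b J Dz HJ; rewrite <- E; [now apply iF | now exists a, b, J].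
- intros E q (a & b & J & Dz & HJ & ->); rewrite iF, iG, E by assumption; easy.
Qed.

Lemma has_stem_slice_fun F G : stem_function D F -> (forall z, D z -> G z = F z) ->
  has_stem F (slice_fun G).
Proof.
intros sF E; split; [exact sF |].
assert (sG : stem_function D G).
{ intros z Dz; rewrite !E by (apply HD || idtac; assumption); now apply sF. }
intros a b J Dz HJ; rewrite <- !E by assumption.
now apply (slice_fun_induced D G HD sG).
Qed.

Lemma has_stem_stem F f : has_stem F f -> forall z, D z -> stem D f z = F z.
Proof. intros [sF iF]; now apply stem_induced. Qed.

Lemma has_stem_mul F G f g : has_stem F f -> has_stem G g ->
  has_stem (fun z => HCmul (F z) (G z)) (smul D f g).
Proof.
intros Hf Hg; apply has_stem_slice_fun.
- intros z Dz; rewrite HCbar_mul, (proj1 Hf), (proj1 Hg); easy.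
- intros z Dz; now rewrite (has_stem_stem _ _ Hf), (has_stem_stem _ _ Hg).
Qed.

Lemma has_stem_conj F f : has_stem F f -> has_stem (fun z => HCconj (F z)) (sconj D f).
Proof.
intros Hf; apply has_stem_slice_fun.
- intros z Dz; rewrite (proj1 Hf) by assumption; generalize (F z); intros X; hreal.
- intros z Dz; now rewrite (has_stem_stem _ _ Hf).
Qed.

Lemma has_stem_add F G f g : has_stem F f -> has_stem G g ->
  has_stem (fun z => HCadd (F z) (G z)) (sadd f g).
Proof.
intros [sF iF] [sG iG]; split.
- intros z Dz; rewrite sF, sG by assumption; generalize (F z), (G z); intros X Y; hreal.
- intros a b J Dz HJ; unfold sadd; rewrite iF, iG by assumption.
  generalize (F (a, b)), (G (a, b)); intros X Y; hreal.
Qed.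

Lemma has_stem_vec F f : has_stem F f -> has_stem (fun z => hvec (F z)) (spartv D f).
Proof.
intros Hf; destruct (has_stem_conj F f Hf) as [_ ic]; destruct Hf as [sF iF]; split.
- intros z Dz; rewrite sF by assumption; generalize (F z); intros X; hreal.
- intros a b J Dz HJ; unfold spartv; rewrite iF, ic by assumption.
  generalize (F (a, b)); intros X; hreal.
Qed.

Lemma has_stem_part0 F f : has_stem F f -> has_stem (fun z => HCsc (h0 (F z))) (spart0 D f).
Proof.
intros Hf; destruct (has_stem_conj F f Hf) as [_ ic]; destruct Hf as [sF iF]; split.
- intros z Dz; rewrite sF by assumption; generalize (F z); intros X; hreal.
- intros a b J Dz HJ; unfold spart0; rewrite iF, ic by assumption.
  generalize (F (a, b)); intros X; hreal.
Qed.

Lemma has_stem_scal r F f : has_stem F f ->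
  has_stem (fun z => HCs (RtoC r) (F z)) (fun q => Hscal r (f q)).
Proof.
intros [sF iF]; split.
- intros z Dz; rewrite sF by assumption; generalize (F z); intros X; hreal.
- intros a b J Dz HJ; rewrite iF by assumption; generalize (F (a, b)); intros X; hreal.
Qed.

Lemma has_stem_const r : has_stem (fun _ => HCsc (RtoC r)) (fun _ => Hreal r).
Proof.
split; [intros z Dz; hreal | intros a b J Dz HJ; hreal].
Qed.

Lemma has_stem_pow F f n : has_stem F f -> has_stem (fun z => hpow (F z) n) (spow D f n).
Proof.
intros Hf; induction n as [| n IH]; cbn [hpow spow].
- exact (has_stem_const 1).
- exact (has_stem_mul _ _ _ _ Hf IH).
Qed.

Lemma HCbar_exp X : HCexp (HCbar X) = HCbar (HCexp X).
Proof.
assert (P : forall n, hterm (HCbar X) n = HCbar (hterm X n)).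
{ intros n; unfold hterm.
  assert (Q : hpow (HCbar X) n = HCbar (hpow X n)).
  { induction n as [| n IH]; cbn [hpow]; [hreal | now rewrite IH, HCbar_mul]. }
  rewrite Q; generalize (hpow X n) (/ INR (fact n)); intros Y r; hreal. }
assert (G : forall l : HC -> C, (forall Y, l (HCbar Y) = Cconj (l Y)) ->
  cser (fun n => l (hterm (HCbar X) n)) = Cconj (cser (fun n => l (hterm X n)))).
{ intros l Hl; unfold cser, Cconj; cbn [fst snd]; rewrite <- Series_opp.
  f_equal; apply Series_ext; intros n; now rewrite P, Hl. }
rewrite (HCbarE (HCexp X)); apply HC_comp;
  [apply (G h0) | apply (G h1) | apply (G h2) | apply (G h3)];
  intros Y; now rewrite HCbarE.
Qed.

(** Each real coordinate of the series at alpha + beta J is a linear combination, with the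
    coordinates of J as coefficients, of the coordinate series of exp (F(z)). *)
Lemma has_stem_exp F f : has_stem F f -> has_stem (fun z => HCexp (F z)) (sexp D f).
Proof.
intros Hf; split.
{ intros z Dz; now rewrite (proj1 Hf), HCbar_exp. }
intros a b J Dz HJ.
destruct (imag_unit_inv J HJ) as (x & y & z & -> & _).
set (J := (0, x, y, z)) in *.
assert (T : forall n, Hscal (/ INR (fact n)) (spow D f n (Hreal a + Hscal b J)%H)
  = (HCre (hterm (F (a, b)) n) + J * HCim (hterm (F (a, b)) n))%H).
{ intros n; rewrite (proj2 (has_stem_pow F f n Hf) a b J Dz HJ); unfold hterm, J.
  generalize (hpow (F (a, b)) n) (/ INR (fact n)); intros Y r; hreal. }
set (X := F (a, b)) in *.
assert (L : forall s0 s1 s2 s3 t0 t1 t2 t3 k1 k2 k3,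
  is_series s0 t0 -> is_series s1 t1 -> is_series s2 t2 -> is_series s3 t3 ->
  is_series (fun n => s0 n + k1 * s1 n + k2 * s2 n + k3 * s3 n)
    (t0 + k1 * t1 + k2 * t2 + k3 * t3)).
{ intros s0 s1 s2 s3 t0 t1 t2 t3 k1 k2 k3 S0 S1 S2 S3.
  exact (is_series_plus _ _ _ _ (is_series_plus _ _ _ _ (is_series_plus _ _ _ _ S0
    (is_series_scal k1 _ _ S1)) (is_series_scal k2 _ _ S2)) (is_series_scal k3 _ _ S3)). }
destruct (HCexp_series X) as ([R0 I0] & [R1 I1] & [R2 I2] & [R3 I3]).
unfold sexp; cbv zeta.
rewrite (Series_ext _ (fun n => Re (h0 (hterm X n)) + (- x) * Im (h1 (hterm X n))
    + (- y) * Im (h2 (hterm X n)) + (- z) * Im (h3 (hterm X n)))),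
  (is_series_unique _ _ (L _ _ _ _ _ _ _ _ (- x) (- y) (- z) R0 I1 I2 I3)).
2: { intros n; rewrite T, HCreE, HCimE; unfold J; Hunfold; ring. }
rewrite (Series_ext (fun n => let '(_, x0, _, _) := _ in x0) (fun n => Re (h1 (hterm X n)) + x * Im (h0 (hterm X n))
    + y * Im (h3 (hterm X n)) + (- z) * Im (h2 (hterm X n)))),
  (is_series_unique _ _ (L _ _ _ _ _ _ _ _ x y (- z) R1 I0 I3 I2)).
2: { intros n; rewrite T, HCreE, HCimE; unfold J; Hunfold; ring. }
rewrite (Series_ext (fun n => let '(_, _, x0, _) := _ in x0) (fun n => Re (h2 (hterm X n)) + (- x) * Im (h3 (hterm X n))
    + y * Im (h0 (hterm X n)) + z * Im (h1 (hterm X n)))),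
  (is_series_unique _ _ (L _ _ _ _ _ _ _ _ (- x) y z R2 I3 I0 I1)).
2: { intros n; rewrite T, HCreE, HCimE; unfold J; Hunfold; ring. }
rewrite (Series_ext (fun n => let '(_, _, _, x0) := _ in x0) (fun n => Re (h3 (hterm X n)) + x * Im (h2 (hterm X n))
    + (- y) * Im (h1 (hterm X n)) + z * Im (h0 (hterm X n)))),
  (is_series_unique _ _ (L _ _ _ _ _ _ _ _ x (- y) z R3 I2 I1 I0)).
2: { intros n; rewrite T, HCreE, HCimE; unfold J; Hunfold; ring. }
rewrite HCreE, HCimE; unfold J; Hunfold; apply H_ext; ring.
Qed.

End Stem.

(** * Parallel vectors, lengths in Z pi and parity *)

Definition hdot (X Y : HC) : C := (h1 X * h1 Y + h2 X * h2 Y + h3 X * h3 Y)%C.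
Definition cross1 (X Y : HC) : C := (h2 X * h3 Y - h3 X * h2 Y)%C.
Definition cross2 (X Y : HC) : C := (h3 X * h1 Y - h1 X * h3 Y)%C.
Definition cross3 (X Y : HC) : C := (h1 X * h2 Y - h2 X * h1 Y)%C.
Definition parallel (X Y : HC) : Prop := cross1 X Y = 0 /\ cross2 X Y = 0 /\ cross3 X Y = 0.

Lemma cos_IZR_PI k : cos (IZR k * PI) = if Z.even k then 1 else -1.
Proof.
assert (P : forall n : nat, cos (INR n * PI) = if Nat.even n then 1 else -1).
{ induction n as [| n IH]; [cbn; now rewrite Rmult_0_l, cos_0 |].
  rewrite S_INR, Rmult_plus_distr_r, Rmult_1_l, neg_cos, IH, Nat.even_succ, <- Nat.negb_even.
  destruct (Nat.even n); cbn; ring. }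
assert (E : forall n : nat, Nat.even n = Z.even (Z.of_nat n)).
{ intros n; apply Bool.eq_true_iff_eq; rewrite Z.even_spec, Nat.even_spec; split.
  - intros [m ->]; exists (Z.of_nat m); lia.
  - intros [m Hm]; exists (Z.to_nat m); lia. }
destruct (Z_le_gt_dec 0 k) as [K | K].
- rewrite <- (Z2Nat.id k K), <- INR_IZR_INZ, P, E; easy.
- replace k with (- Z.of_nat (Z.to_nat (- k)))%Z by lia.
  rewrite opp_IZR, Ropp_mult_distr_l_reverse, cos_neg, <- INR_IZR_INZ, P, E, Z.even_opp; easy.
Qed.

Lemma cos_parity n m p :
  cos (IZR p * PI) = cos (IZR n * PI) * cos (IZR m * PI) <-> ((n + m) mod 2 = p mod 2)%Z.
Proof.
rewrite !cos_IZR_PI, !Zmod_even, Z.even_add.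
destruct (Z.even n), (Z.even m), (Z.even p); cbn; split; intros; lia || lra || (exfalso; lra).
Qed.

Lemma pi_multiples_close k n : Rabs (IZR k * PI - IZR n * PI) < 1 -> k = n.
Proof.
intros Hk; rewrite <- Rmult_minus_distr_r, Rabs_mult, (Rabs_right PI), <- minus_IZR, <- abs_IZR in Hk
  by (pose proof PI_RGT_0; lra).
assert (P : 1 < PI) by (pose proof PI2_1; lra).
enough (Z.abs (k - n) < 1)%Z by lia.
apply lt_IZR; apply Rnot_le_lt; intros L; nra.
Qed.

Lemma hvec_square X r : hdot X X = RtoC (Rsqr r) ->
  HCmul (hvec X) (hvec X) = HCs (RtoC (- Rsqr r)) HCone.
Proof.
intros E; rewrite RtoC_opp, <- E; unfold hdot, hvec; hring.
Qed.

(** With r = n pi, the vector part of cos r + (sin r / r) A disappears. *)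
Lemma HCexp_hvec_pi X n : n <> 0%Z -> hdot X X = RtoC (IZR n ^ 2 * PI ^ 2) ->
  HCexp (hvec X) = HCs (RtoC (cos (IZR n * PI))) HCone.
Proof.
intros N E; rewrite (HCexp_trig (hvec X) (IZR n * PI)).
- assert (S : sinc (IZR n * PI) = 0).
  { assert (Z : IZR n * PI <> 0).
    { apply Rmult_integral_contrapositive_currified; [now apply not_0_IZR | apply PI_neq0]. }
    apply (Rmult_eq_reg_l _ _ _) with (2 := Z); rewrite <- sin_sinc, Rmult_0_r.
    apply sin_eq_0_1; now exists n. }
  rewrite S; hring.
- apply hvec_square; rewrite E; f_equal; unfold Rsqr; ring.
Qed.

(** The commutator of two vectors is twice their cross product. *)
Lemma parallel_comm X Y : parallel X Y -> HCmul (hvec X) (hvec Y) = HCmul (hvec Y) (hvec X).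
Proof.
intros (C1 & C2 & C3).
assert (E : HCmul (hvec X) (hvec Y) = HCadd (HCmul (hvec Y) (hvec X))
  (HCs 2 (RtoC 0, cross1 X Y, cross2 X Y, cross3 X Y))).
{ unfold cross1, cross2, cross3, hvec; hring. }
rewrite E, C1, C2, C3; hring.
Qed.

(** * The two implications *)

Section Main.
Variable D : C -> Prop.
Hypothesis hD : circular_domain D.
Let HD : conj_invariant D := proj1 hD.

Lemma no_zero_divisors (p h : C -> C) z1 :
  (forall z, D z -> cdiff p z) -> (forall z, D z -> cdiff h z) ->
  (forall z, D z -> h (Cconj z) = Cconj (h z)) ->
  D z1 -> p z1 <> 0 -> (forall z, D z -> (p z * h z)%C = 0) ->
  forall z, D z -> h z = 0.
Proof.
intros pd hd hc Dz1 pz ph.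
pose proof (cdiff_cont _ _ (pd z1 Dz1)) as cp; rewrite ccontE in cp.
destruct (cp (Cmod (p z1))) as (d & d0 & Hd); [now apply Cmod_gt_0 |].
destruct (domain_open D hD z1 Dz1) as (e & e0 & He).
apply (identity_theorem D h hD hd hc z1 (Rmin d e) Dz1); [now apply Rmin_case |].
intros t Ht.
assert (Q : Cmod (z1 + RtoC t - z1) < Rmin d e).
{ replace (z1 + RtoC t - z1)%C with (RtoC t) by ring; now rewrite Cmod_R. }
pose proof (He _ (Rlt_le_trans _ _ _ Q (Rmin_r _ _))) as Dt.
pose proof (Hd _ (Rlt_le_trans _ _ _ Q (Rmin_l _ _))) as pt.
apply NNPP; intros N; apply ph in Dt; revert Dt; apply Cmult_neq_0; [| exact N].
intros Z; rewrite Z in pt.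
replace (RtoC 0 - p z1)%C with (- p z1)%C in pt by ring; rewrite Cmod_opp in pt; lra.
Qed.

(** The length rho is continuous near x1 with values in Z pi, hence constant there; the
    identity theorem extends the resulting value of S to D. *)
Lemma quantize (S : C -> C) (rho : R -> R) x1 del :
  (forall z, D z -> cdiff S z) -> (forall z, D z -> S (Cconj z) = Cconj (S z)) ->
  D (x1, 0) -> 0 < del ->
  (forall x, Rabs (x - x1) < del ->
     S (x, 0) = RtoC (Rsqr (rho x)) /\ 0 < rho x /\ sin (rho x) = 0) ->
  exists n : Z, n <> 0%Z /\ rho x1 = IZR n * PI /\
    forall z, D z -> S z = RtoC (IZR n ^ 2 * PI ^ 2).
Proof.
intros Sd Sc D1 del0 Hr.
destruct (Hr x1) as (E1 & P1 & S1); [rewrite Rminus_diag, Rabs_R0; exact del0 |].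
destruct (sin_eq_0_0 _ S1) as [n Hn].
exists n; split; [| split; [exact Hn |]].
{ intros ->; rewrite Hn in P1; lra. }
assert (Cr : continuous (fun x => sqrt (Re (S (x, 0)))) x1).
{ apply (continuous_comp (fun x => Re (S (x, 0))) sqrt); [| apply continuous_sqrt].
  apply (horizontal_pcont S x1 x1 0); [| lra].
  intros x Hx; replace x with x1 by lra; now apply cdiff_cont, Sd. }
destruct (Cr (ball (sqrt (Re (S (x1, 0)))) (mkposreal 1 Rlt_0_1)) (locally_ball _ _)) as [d Hd].
assert (K : forall x, Rabs (x - x1) < Rmin d del -> S (x, 0) = RtoC (IZR n ^ 2 * PI ^ 2)).
{ intros x Hx.
  destruct (Hr x (Rlt_le_trans _ _ _ Hx (Rmin_r _ _))) as (E & P & S0).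
  destruct (sin_eq_0_0 _ S0) as [k Hk].
  assert (B : Rabs (sqrt (Re (S (x, 0))) - sqrt (Re (S (x1, 0)))) < 1)
    by exact (Hd x (Rlt_le_trans _ _ _ Hx (Rmin_l _ _))).
  rewrite E, E1 in B; unfold Re, RtoC in B; cbn [fst] in B.
  rewrite !sqrt_Rsqr, Hk, Hn in B by lra; apply pi_multiples_close in B; subst k.
  rewrite E, Hk; f_equal; unfold Rsqr; ring. }
intros z Dz.
enough (G : (S z - RtoC (IZR n ^ 2 * PI ^ 2))%C = 0).
{ rewrite <- (Cplus_0_r (RtoC _)), <- G; ring. }
apply (identity_theorem D (fun z => S z - RtoC (IZR n ^ 2 * PI ^ 2))%C hD)
  with (z0 := (x1, 0)) (del := Rmin d del); try assumption.
- intros w Dw; apply cdiff_minus; [now apply Sd | apply cdiff_const].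
- intros w Dw; rewrite Sc, Cminus_conj by exact Dw; f_equal.
  unfold Cconj, RtoC; cbn; now rewrite Ropp_0.
- apply Rmin_case; [apply cond_pos | exact del0].
- intros t Ht; replace ((x1, 0) + RtoC t)%C with (x1 + t, 0)
    by (unfold RtoC, Cplus; cbn; f_equal; ring).
  rewrite K; [ring |]; now replace (x1 + t - x1) with t by ring.
Qed.

Lemma scalar_preserving (c : C -> C) :
  (forall z, D z -> ex_derive (K := C_AbsRing) (V := C_NormedModule) c z) ->
  (forall z, D z -> c (Cconj z) = Cconj (c z)) ->
  has_stem D (fun z => HCsc (c z)) (slice_fun (fun z => HCsc (c z))) /\
  slice_regular_preserving D (slice_fun (fun z => HCsc (c z))).
Proof.
intros cd cc.
assert (Hs : has_stem D (fun z => HCsc (c z)) (slice_fun (fun z => HCsc (c z)))).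
{ apply has_stem_slice_fun; [exact HD | | easy].
  intros z Dz; rewrite cc by exact Dz; generalize (c z); intros [u v]; hreal. }
split; [exact Hs |]; exists (fun z => HCsc (c z)); split; [apply Hs | split; [apply Hs | split]].
- intros z Dz; apply (ex_derive_linear c HCsc z is_linear_HCsc); now apply cd.
- intros z _; exists (Re (c z)), (Im (c z)); destruct (c z); split; reflexivity.
Qed.

(** The pointwise product by a slice-preserving function is the product of stems, since
    real coefficients commute with the imaginary unit of the slice. *)
Lemma has_stem_scalar_mul (c : C -> C) F a f :
  has_stem D (fun z => HCsc (c z)) a -> has_stem D F f ->
  has_stem D (fun z => HCs (c z) (F z)) (fun q => a q * f q)%H.
Proof.
intros [sc ic] [sF iF]; split.
- intros z Dz; pose proof (sc z Dz) as E; rewrite sF by exact Dz.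
  apply (f_equal h0) in E; rewrite HCbarE in E; unfold HCsc, h0 in E; cbn [fst snd] in E.
  rewrite E; generalize (F z), (c z); intros X [u v]; hreal.
- intros x y J Dz HJ; rewrite ic, iF by assumption.
  destruct (imag_unit_inv J HJ) as (j1 & j2 & j3 & -> & N); clear HJ.
  generalize (F (x, y)), (c (x, y)); intros [[[[p0 q0] [p1 q1]] [p2 q2]] [p3 q3]] [u v].
  assert (K : forall q l r, l - r = - v * q * (j1 * j1 + j2 * j2 + j3 * j3 - 1) -> l = r).
  { intros q l r E; apply Rminus_diag_uniq; rewrite E, N; ring. }
  hreal; [apply (K q0) | apply (K q1) | apply (K q2) | apply (K q3)]; ring.
Qed.

Variable x0 : R.
Hypothesis Dx0 : D (x0, 0).

Variables (F G : C -> HC) (f g : H -> H).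
Hypotheses (Ff : has_stem D F f) (Gg : has_stem D G g).
Hypotheses (Fh : holomorphic D F) (Gh : holomorphic D G).

Lemma stem_cdiff K z : holomorphic D K -> D z ->
  cdiff (fun w => h1 (K w)) z /\ cdiff (fun w => h2 (K w)) z /\ cdiff (fun w => h3 (K w)) z.
Proof.
intros Kh Dz; split; [| split]; apply ex_derive_cdiff;
  [apply (ex_derive_linear K h1 z is_linear_h1)
  |apply (ex_derive_linear K h2 z is_linear_h2)
  |apply (ex_derive_linear K h3 z is_linear_h3)]; now apply Kh.
Qed.

Lemma exp_equation_stem :
  (forall q, Omega D q -> sexp D (sadd f g) q = smul D (sexp D f) (sexp D g) q) <->
  (forall z, D z -> HCexp (HCadd (hvec (F z)) (hvec (G z)))
     = HCmul (HCexp (hvec (F z))) (HCexp (hvec (G z)))).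
Proof.
rewrite (has_stem_eq D HD (fun z => HCexp (HCadd (F z) (G z)))
  (fun z => HCmul (HCexp (F z)) (HCexp (G z)))).
- split; intros E z Dz; [exact (proj1 (HCexp_vec (F z) (G z)) (E z Dz))
    | exact (proj2 (HCexp_vec (F z) (G z)) (E z Dz))].
- apply has_stem_exp, has_stem_add; assumption.
- apply has_stem_mul; [assumption | |]; now apply has_stem_exp.
Qed.

Lemma cross_props : forall c, c = cross1 \/ c = cross2 \/ c = cross3 ->
  (forall z, D z -> cdiff (fun w => c (F w) (G w)) z) /\
  (forall z, D z -> c (F (Cconj z)) (G (Cconj z)) = Cconj (c (F z) (G z))).
Proof.
intros c Hc; split; intros z Dz.
- destruct (stem_cdiff F z Fh Dz) as (F1 & F2 & F3), (stem_cdiff G z Gh Dz) as (G1 & G2 & G3).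
  destruct Hc as [-> | [-> | ->]]; apply cdiff_minus; now apply cdiff_mult.
- rewrite (proj1 Ff z Dz), (proj1 Gg z Dz), !HCbarE.
  destruct Hc as [-> | [-> | ->]]; unfold cross1, cross2, cross3, h1, h2, h3; cbn [fst snd];
  now rewrite Cminus_conj, !Cmult_conj.
Qed.

(** If some coordinate l of A is not identically zero, then - l(B) A + l(A) B = 0 is a
    nontrivial relation: its coordinates are 2 x 2 minors of (A, B), that is, coordinates of
    the cross product.  If A = 0, take the coefficients 1 and 0. *)
Lemma dependent_of_parallel : (forall z, D z -> parallel (F z) (G z)) ->
  linearly_dependent D (spartv D f) (spartv D g).
Proof.
intros Par.
assert (Go : forall l : HC -> C, is_linear (K := C_AbsRing) (V := C_NormedModule) l ->
  (forall X, l (HCbar X) = Cconj (l X)) ->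
  (forall X Y, parallel X Y ->
     HCadd (HCs (- l Y) (hvec X)) (HCs (l X) (hvec Y)) = HCsc 0) ->
  (exists z, D z /\ l (F z) <> 0) -> linearly_dependent D (spartv D f) (spartv D g)).
{ intros l Hl lb lp (z1 & Dz1 & N).
  destruct (scalar_preserving (fun z => - l (G z))%C) as [Sa Pa].
  { intros z Dz; apply (ex_derive_linear G (fun X => - l X)%C z); [| now apply Gh].
    exact (is_linear_comp _ _ Hl is_linear_opp). }
  { intros z Dz; rewrite (proj1 Gg z Dz), lb; destruct (l (G z)); unfold Cconj, Copp; cbn; easy. }
  destruct (scalar_preserving (fun z => l (F z))) as [Sb Pb].
  { intros z Dz; apply (ex_derive_linear F l z Hl); now apply Fh. }
  { intros z Dz; now rewrite (proj1 Ff z Dz), lb. }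
  exists (slice_fun (fun z => HCsc (- l (G z)))%C), (slice_fun (fun z => HCsc (l (F z)))).
  split; [exact Pa | split; [exact Pb | split]].
  - intros Z; apply N.
    assert (E : forall z, D z -> HCsc (l (F z)) = HCsc (RtoC 0)).
    { apply (has_stem_eq D HD _ _ _ _ Sb (has_stem_const D 0)); intros q Hq; now apply Z. }
    specialize (E z1 Dz1); now apply (f_equal h0) in E.
  - apply (has_stem_eq D HD (fun z => HCadd (HCs (- l (G z)) (hvec (F z)))
      (HCs (l (F z)) (hvec (G z)))) (fun _ => HCsc (RtoC 0)) _ (fun _ => Hreal 0)).
    + apply (has_stem_add D); (apply has_stem_scalar_mul; [assumption |]);
        now apply has_stem_vec.
    + apply has_stem_const.
    + intros z Dz; apply lp; now apply Par. }
destruct (classic (exists z, D z /\ h1 (F z) <> 0)) as [E1 | E1].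
{ apply (Go h1); [exact is_linear_h1 | intros X; now rewrite HCbarE | | exact E1].
  intros X Y (C1 & C2 & C3); transitivity (RtoC 0, RtoC 0, cross3 X Y, - cross2 X Y)%C.
  - unfold cross2, cross3, hvec; hring.
  - rewrite C2, C3; unfold HCsc; hring. }
destruct (classic (exists z, D z /\ h2 (F z) <> 0)) as [E2 | E2].
{ apply (Go h2); [exact is_linear_h2 | intros X; now rewrite HCbarE | | exact E2].
  intros X Y (C1 & C2 & C3); transitivity (RtoC 0, - cross3 X Y, RtoC 0, cross1 X Y)%C.
  - unfold cross1, cross3, hvec; hring.
  - rewrite C1, C3; unfold HCsc; hring. }
destruct (classic (exists z, D z /\ h3 (F z) <> 0)) as [E3 | E3].
{ apply (Go h3); [exact is_linear_h3 | intros X; now rewrite HCbarE | | exact E3].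
  intros X Y (C1 & C2 & C3); transitivity (RtoC 0, cross2 X Y, - cross1 X Y, RtoC 0)%C.
  - unfold cross1, cross2, hvec; hring.
  - rewrite C1, C2; unfold HCsc; hring. }
assert (E : forall z, D z -> hvec (F z) = HCsc 0).
{ intros z Dz; unfold hvec, HCsc; repeat f_equal; apply NNPP; intros N;
    [apply E1 | apply E2 | apply E3]; now exists z. }
assert (C : forall r, slice_regular_preserving D (fun _ => Hreal r)).
{ intros r; exists (fun _ => HCsc (RtoC r)); destruct (has_stem_const D r) as [s i].
  split; [exact s | split; [exact i | split]].
  - intros z _; apply ex_derive_const.
  - intros z _; exists r, 0; split; reflexivity. }
exists (fun _ => Hreal 1), (fun _ => Hreal 0).
split; [apply C | split; [apply C | split]].
- intros Z; destruct (Z (Hreal x0)) as [Z1 _].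
  + exists x0, 0, (0, 1, 0, 0); split; [exact Dx0 | split; [exact imag_unit_i |]].
    Hunfold; apply H_ext; ring.
  + unfold Hreal in Z1; injection Z1; lra.
- apply (has_stem_eq D HD (fun z => HCadd (HCs (RtoC 1) (hvec (F z))) (HCs (RtoC 0) (hvec (G z))))
    (fun _ => HCsc (RtoC 0)) _ (fun _ => Hreal 0)).
  + apply (has_stem_add D);
      (apply (has_stem_scalar_mul (fun _ => RtoC _)); [apply has_stem_const |]);
      now apply has_stem_vec.
  + apply has_stem_const.
  + intros z Dz; rewrite (E z Dz); unfold HCsc; hring.
Qed.

(** With p and q the stems of the two coefficients, p A + q B = 0 gives
    p (A x B) = - q (B x B) = 0 and likewise q (A x B) = 0; there are no zero divisors. *)
Lemma parallel_of_dependent : linearly_dependent D (spartv D f) (spartv D g) ->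
  forall z, D z -> parallel (F z) (G z).
Proof.
intros (al & be & (P & sP & iP & hP & rP) & (Q & sQ & iQ & hQ & rQ) & N & E).
assert (sc : forall (K : C -> HC), (forall z, D z -> exists r s : R, HCre (K z) = Hreal r /\
  HCim (K z) = Hreal s) -> forall z, D z -> K z = HCsc (h0 (K z))).
{ intros K rK z Dz; destruct (rK z Dz) as (r & s & E1 & E2).
  revert E1 E2; generalize (K z); intros [[[[a a'] [b b']] [c c']] [e e']] E1 E2.
  injection E1; injection E2; intros; subst; reflexivity. }
assert (hs : forall (K : C -> HC) k, stem_function D K -> induces D K k ->
  (forall z, D z -> K z = HCsc (h0 (K z))) -> has_stem D (fun z => HCsc (h0 (K z))) k).
{ intros K k sK iK eK; split.
  - intros z Dz; rewrite <- !eK; [now apply sK | exact Dz | now apply HD].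
  - intros a b J Dz HJ; rewrite <- eK by exact Dz; now apply iK. }
pose proof (sc P rP) as eP; pose proof (sc Q rQ) as eQ.
pose proof (hs P al sP iP eP) as Pal; pose proof (hs Q be sQ iQ eQ) as Qbe.
assert (R : forall z, D z -> HCadd (HCs (h0 (P z)) (hvec (F z))) (HCs (h0 (Q z)) (hvec (G z)))
  = HCsc (RtoC 0)).
{ refine (proj1 (has_stem_eq D HD _ _ _ (fun _ => Hreal 0)
    (has_stem_add D _ _ _ _
      (has_stem_scalar_mul _ _ _ _ Pal (has_stem_vec D HD F f Ff))
      (has_stem_scalar_mul _ _ _ _ Qbe (has_stem_vec D HD G g Gg)))
    (has_stem_const D 0)) E). }
assert (Cz : forall c, c = cross1 \/ c = cross2 \/ c = cross3 -> forall z, D z ->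
  (h0 (P z) * c (F z) (G z))%C = 0 /\ (h0 (Q z) * c (F z) (G z))%C = 0).
{ intros c Hc z Dz; pose proof (R z Dz) as Rz.
  revert Rz; generalize (F z) (G z) (h0 (P z)) (h0 (Q z)); intros X Y p q Rz.
  assert (R1 : (p * h1 X + q * h1 Y)%C = 0) by exact (f_equal h1 Rz).
  assert (R2 : (p * h2 X + q * h2 Y)%C = 0) by exact (f_equal h2 Rz).
  assert (R3 : (p * h3 X + q * h3 Y)%C = 0) by exact (f_equal h3 Rz).
  destruct Hc as [-> | [-> | ->]]; unfold cross1, cross2, cross3; split.
  - transitivity ((p * h2 X + q * h2 Y) * h3 Y - (p * h3 X + q * h3 Y) * h2 Y)%C;
      [ring | rewrite R2, R3; ring].
  - transitivity ((p * h3 X + q * h3 Y) * h2 X - (p * h2 X + q * h2 Y) * h3 X)%C;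
      [ring | rewrite R2, R3; ring].
  - transitivity ((p * h3 X + q * h3 Y) * h1 Y - (p * h1 X + q * h1 Y) * h3 Y)%C;
      [ring | rewrite R1, R3; ring].
  - transitivity ((p * h1 X + q * h1 Y) * h3 X - (p * h3 X + q * h3 Y) * h1 X)%C;
      [ring | rewrite R1, R3; ring].
  - transitivity ((p * h1 X + q * h1 Y) * h2 Y - (p * h2 X + q * h2 Y) * h1 Y)%C;
      [ring | rewrite R1, R2; ring].
  - transitivity ((p * h2 X + q * h2 Y) * h1 X - (p * h1 X + q * h1 Y) * h2 X)%C;
      [ring | rewrite R1, R2; ring]. }
assert (hd : forall K : C -> HC, holomorphic D K -> forall z, D z -> cdiff (fun w => h0 (K w)) z).
{ intros K hK z Dz; apply ex_derive_cdiff, (ex_derive_linear K h0 z is_linear_h0), hK, Dz. }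
assert (W : exists z, D z /\ (h0 (P z) <> 0 \/ h0 (Q z) <> 0)).
{ apply NNPP; intros M; apply N; intros q Hq.
  assert (Z : forall z, D z -> h0 (P z) = 0 /\ h0 (Q z) = 0).
  { intros z Dz; split; apply NNPP; intros U; apply M; exists z; tauto. }
  split; revert q Hq.
  - apply (has_stem_eq D HD _ _ _ (fun _ => Hreal 0) Pal (has_stem_const D 0)).
    intros z Dz; now rewrite (proj1 (Z z Dz)).
  - apply (has_stem_eq D HD _ _ _ (fun _ => Hreal 0) Qbe (has_stem_const D 0)).
    intros z Dz; now rewrite (proj2 (Z z Dz)). }
destruct W as (z1 & Dz1 & W).
assert (Fin : forall c, c = cross1 \/ c = cross2 \/ c = cross3 -> forall z, D z ->
  c (F z) (G z) = 0).
{ intros c Hc; destruct (cross_props c Hc) as [cd cc].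
  destruct W as [W | W].
  - apply (no_zero_divisors (fun w => h0 (P w)) (fun w => c (F w) (G w)) z1 (hd P hP) cd cc Dz1 W).
    intros z Dz; now apply Cz.
  - apply (no_zero_divisors (fun w => h0 (Q w)) (fun w => c (F w) (G w)) z1 (hd Q hQ) cd cc Dz1 W).
    intros z Dz; now apply Cz. }
intros z Dz; repeat split; apply Fin; tauto.
Qed.

Lemma ssym_const_iff K k r : has_stem D K k ->
  (forall q, Omega D q -> ssym D (spartv D k) q = Hreal r) <->
  (forall z, D z -> hdot (K z) (K z) = RtoC r).
Proof.
intros Kk; unfold ssym.
pose proof (has_stem_vec D HD K k Kk) as V.
rewrite (has_stem_eq D HD _ _ _ (fun _ => Hreal r)
  (has_stem_mul D HD _ _ _ _ V (has_stem_conj D HD _ _ V)) (has_stem_const D r)).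
assert (E : forall z, HCmul (hvec (K z)) (HCconj (hvec (K z))) = HCsc (hdot (K z) (K z))).
{ intros z; rewrite HCconjE; unfold hdot, hvec, HCsc; hring. }
split; intros A z Dz; specialize (A z Dz); rewrite E in *.
- now apply (f_equal h0) in A.
- now rewrite A.
Qed.

Lemma sinner_const_iff r :
  (forall q, Omega D q -> Hscal 2 (sinner D (spartv D f) (spartv D g) q) = Hreal r) <->
  (forall z, D z -> (2 * hdot (F z) (G z))%C = RtoC r).
Proof.
unfold sinner.
rewrite (has_stem_eq D HD _ _ _ (fun _ => Hreal r)
  (has_stem_scal D 2 _ _ (has_stem_part0 D HD _ _ (has_stem_mul D HD _ _ _ _
     (has_stem_vec D HD F f Ff) (has_stem_conj D HD _ _ (has_stem_vec D HD G g Gg)))))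
  (has_stem_const D r)).
assert (E : forall z, HCs (RtoC 2) (HCsc (h0 (HCmul (hvec (F z)) (HCconj (hvec (G z))))))
  = HCsc (2 * hdot (F z) (G z))%C).
{ intros z; rewrite HCconjE; unfold hdot, hvec, HCsc; hring. }
split; intros A z Dz; specialize (A z Dz); rewrite E in *.
- now apply (f_equal h0) in A.
- now rewrite A.
Qed.

Lemma hdot_add X Y : hdot (HCadd X Y) (HCadd X Y)
  = (hdot X X + hdot Y Y + 2 * hdot X Y)%C.
Proof. unfold hdot, HCadd, h1, h2, h3; cbn [fst snd]; ring. Qed.

(** The symmetry of the stem makes its values on the real axis real. *)
Lemma real_axis K k x : has_stem D K k -> D (x, 0) ->
  hvec (K (x, 0)) = rvec (Re (h1 (K (x, 0)))) (Re (h2 (K (x, 0)))) (Re (h3 (K (x, 0)))).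
Proof.
intros [sK _] Dx; pose proof (sK _ Dx) as E.
replace (Cconj (x, 0)) with (x, 0) in E by (unfold Cconj; cbn; now rewrite Ropp_0).
assert (Q : forall l : HC -> C, (forall X, l (HCbar X) = Cconj (l X)) ->
  l (K (x, 0)) = RtoC (Re (l (K (x, 0))))).
{ intros l Hl; apply (f_equal l) in E; rewrite Hl in E.
  destruct (l (K (x, 0))) as [u v]; unfold Cconj in E; cbn in E; injection E as E.
  unfold RtoC, Re; cbn; f_equal; lra. }
unfold hvec, rvec; rewrite <- (Q h1), <- (Q h2), <- (Q h3); try easy;
  intros X; now rewrite HCbarE.
Qed.

(** By the identity theorem, a coordinate of A x B that is not identically zero on D is
    nonzero somewhere on the real axis, and then on a real interval. *)
Lemma not_parallel_real : ~ (forall z, D z -> parallel (F z) (G z)) ->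
  exists x1 del, 0 < del /\ forall x, Rabs (x - x1) < del ->
    D (x, 0) /\ ~ parallel (F (x, 0)) (G (x, 0)).
Proof.
intros N.
assert (W : exists c, (c = cross1 \/ c = cross2 \/ c = cross3) /\
  ~ (forall z, D z -> c (F z) (G z) = 0)).
{ apply NNPP; intros M; apply N; intros z Dz; repeat split; apply NNPP; intros U; apply M;
    [exists cross1 | exists cross2 | exists cross3]; (split; [tauto |]);
    intros V; apply U; now apply V. }
destruct W as (c & Hc & Nc).
destruct (cross_props c Hc) as [cd cc].
destruct (domain_open D hD _ Dx0) as (e & e0 & He).
assert (W : exists t, Rabs t < e /\ c (F (x0 + t, 0)) (G (x0 + t, 0)) <> 0).
{ apply NNPP; intros M; apply Nc.
  apply (identity_theorem D (fun w => c (F w) (G w)) hD cd cc (x0, 0) e Dx0 e0).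
  intros t Ht; replace ((x0, 0) + RtoC t)%C with (x0 + t, 0)
    by (unfold RtoC, Cplus; cbn; f_equal; ring).
  apply NNPP; intros U; apply M; now exists t. }
destruct W as (t & Ht & Nt).
assert (sub : forall x y, Cmod ((x, 0) - (y, 0)) = Rabs (x - y)).
{ intros x y; replace ((x, 0) - (y, 0))%C with (RtoC (x - y)); [apply Cmod_R |].
  unfold RtoC, Cminus, Cplus, Copp; cbn; f_equal; ring. }
assert (Dt : D (x0 + t, 0)).
{ apply He; rewrite sub; now replace (x0 + t - x0) with t by ring. }
destruct (domain_open D hD _ Dt) as (e1 & e10 & He1).
pose proof (cdiff_cont _ _ (cd _ Dt)) as Ct; rewrite ccontE in Ct.
destruct (Ct (Cmod (c (F (x0 + t, 0)) (G (x0 + t, 0))))) as (e2 & e20 & He2);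
  [now apply Cmod_gt_0 |].
exists (x0 + t), (Rmin e1 e2); split; [now apply Rmin_case |].
intros x Hx; rewrite <- sub in Hx; split.
- apply He1, (Rlt_le_trans _ _ _ Hx), Rmin_l.
- intros P; pose proof (He2 _ (Rlt_le_trans _ _ _ Hx (Rmin_r _ _))) as B.
  assert (Z : c (F (x, 0)) (G (x, 0)) = 0)
    by (destruct P as (P1 & P2 & P3), Hc as [-> | [-> | ->]]; assumption).
  rewrite Z in B; set (u := c _ _) in B.
  replace (RtoC 0 - u)%C with (- u)%C in B by ring; rewrite Cmod_opp in B; lra.
Qed.

Lemma hdot_props K1 K2 k1 k2 : has_stem D K1 k1 -> has_stem D K2 k2 ->
  holomorphic D K1 -> holomorphic D K2 ->
  (forall z, D z -> cdiff (fun w => hdot (K1 w) (K2 w)) z) /\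
  (forall z, D z -> hdot (K1 (Cconj z)) (K2 (Cconj z)) = Cconj (hdot (K1 z) (K2 z))).
Proof.
intros [s1 _] [s2 _] d1 d2; split; intros z Dz.
- destruct (stem_cdiff K1 z d1 Dz) as (A1 & A2 & A3), (stem_cdiff K2 z d2 Dz) as (B1 & B2 & B3).
  apply cdiff_plus; [apply cdiff_plus |]; now apply cdiff_mult.
- rewrite s1, s2, !HCbarE by exact Dz; unfold hdot, h1, h2, h3; cbn [fst snd].
  now rewrite !Cplus_conj, !Cmult_conj.
Qed.

Lemma integers_of_not_parallel :
  (forall z, D z -> HCexp (HCadd (hvec (F z)) (hvec (G z)))
     = HCmul (HCexp (hvec (F z))) (HCexp (hvec (G z)))) ->
  ~ (forall z, D z -> parallel (F z) (G z)) ->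
  exists n m p : Z, n <> 0%Z /\ m <> 0%Z /\ p <> 0%Z /\
    (forall z, D z -> hdot (F z) (F z) = RtoC (IZR n ^ 2 * PI ^ 2)) /\
    (forall z, D z -> hdot (G z) (G z) = RtoC (IZR m ^ 2 * PI ^ 2)) /\
    (forall z, D z -> (2 * hdot (F z) (G z))%C
       = RtoC ((IZR p ^ 2 - IZR n ^ 2 - IZR m ^ 2) * PI ^ 2)) /\
    ((n + m) mod 2 = p mod 2)%Z.
Proof.
intros E N; destruct (not_parallel_real N) as (x1 & del & del0 & Hdel).
pose (a := fun i x => Re (i (F (x, 0))) : R); pose (b := fun i x => Re (i (G (x, 0))) : R).
pose (ra := fun x => rlen (a h1 x) (a h2 x) (a h3 x)).
pose (rb := fun x => rlen (b h1 x) (b h2 x) (b h3 x)).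
pose (rp := fun x => rlen (a h1 x + b h1 x) (a h2 x + b h2 x) (a h3 x + b h3 x)).
assert (Ax : forall x, D (x, 0) -> hvec (F (x, 0)) = rvec (a h1 x) (a h2 x) (a h3 x))
  by (intros x Dx; exact (real_axis F f x Ff Dx)).
assert (Bx : forall x, D (x, 0) -> hvec (G (x, 0)) = rvec (b h1 x) (b h2 x) (b h3 x))
  by (intros x Dx; exact (real_axis G g x Gg Dx)).
assert (K : forall x, Rabs (x - x1) < del -> sin (ra x) = 0 /\ sin (rb x) = 0 /\
  sin (rp x) = 0 /\ cos (rp x) = cos (ra x) * cos (rb x) /\ 0 < ra x /\ 0 < rb x /\ 0 < rp x).
{ intros x Hx; destruct (Hdel x Hx) as [Dx Nx].
  apply noncommuting_exp.
  - rewrite <- Ax, <- Bx by exact Dx; now apply E.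
  - apply NNPP; intros M; apply Nx.
    assert (T : forall X Y, parallel (hvec X) (hvec Y) -> parallel X Y) by easy.
    apply T; rewrite Ax, Bx by exact Dx.
    unfold parallel, cross1, cross2, cross3, rvec, h1, h2, h3; cbn [fst snd].
    rewrite <- !RtoC_mult, <- !RtoC_minus; repeat split; f_equal; apply NNPP; tauto. }
assert (Sq : forall u v w, hdot (rvec u v w) (rvec u v w) = RtoC (Rsqr (rlen u v w))).
{ intros u v w; rewrite rlen_sqr, !RtoC_plus, !RtoC_mult; unfold hdot, rvec, h1, h2, h3;
  cbn [fst snd]; ring. }
assert (Hv : forall X, hdot X X = hdot (hvec X) (hvec X)) by easy.
destruct (hdot_props F F f f Ff Ff Fh Fh) as [FFd FFc].
destruct (hdot_props G G g g Gg Gg Gh Gh) as [GGd GGc].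
destruct (hdot_props F G f g Ff Gg Fh Gh) as [FGd FGc].
assert (D1 : D (x1, 0)) by (apply Hdel; rewrite Rminus_diag, Rabs_R0; exact del0).
destruct (quantize (fun z => hdot (F z) (F z)) ra x1 del FFd FFc D1 del0) as (n & n0 & Rn & En).
{ intros x Hx; destruct (K x Hx) as (K1 & K2 & K3 & K4 & K5 & K6 & K7).
  split; [| now split]; rewrite Hv, Ax by apply (Hdel x Hx); apply Sq. }
destruct (quantize (fun z => hdot (G z) (G z)) rb x1 del GGd GGc D1 del0) as (m & m0 & Rm & Em).
{ intros x Hx; destruct (K x Hx) as (K1 & K2 & K3 & K4 & K5 & K6 & K7).
  split; [| now split]; rewrite Hv, Bx by apply (Hdel x Hx); apply Sq. }
destruct (quantize (fun z => (hdot (F z) (F z) + hdot (G z) (G z) + 2 * hdot (F z) (G z))%C)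
  rp x1 del) as (p & p0 & Rp & Ep); try assumption.
{ intros z Dz; apply cdiff_plus; [apply cdiff_plus; [now apply FFd | now apply GGd] |].
  apply cdiff_mult; [apply cdiff_const | now apply FGd]. }
{ intros z Dz; rewrite FFc, GGc, FGc by exact Dz; rewrite !Cplus_conj, Cmult_conj.
  do 2 f_equal; unfold Cconj, RtoC; cbn; now rewrite Ropp_0. }
{ intros x Hx; destruct (K x Hx) as (K1 & K2 & K3 & K4 & K5 & K6 & K7).
  split; [| now split]; rewrite <- hdot_add, Hv.
  destruct (Hdel x Hx) as [Dx _].
  replace (hvec (HCadd (F (x, 0)) (G (x, 0)))) with (HCadd (hvec (F (x, 0))) (hvec (G (x, 0))))
    by (unfold hvec; hring).
  rewrite Ax, Bx by exact Dx; unfold rp; rewrite <- Sq; f_equal;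
  unfold rvec; rewrite !RtoC_plus; hring. }
exists n, m, p; repeat (split; [assumption |]); split.
- intros z Dz; specialize (En z Dz); specialize (Em z Dz); specialize (Ep z Dz).
  cbv beta in En, Em, Ep; rewrite En, Em in Ep.
  replace ((IZR p ^ 2 - IZR n ^ 2 - IZR m ^ 2) * PI ^ 2)
    with (IZR p ^ 2 * PI ^ 2 - IZR n ^ 2 * PI ^ 2 - IZR m ^ 2 * PI ^ 2) by ring.
  rewrite !(RtoC_minus _ (_ * _)), <- Ep; ring.
- apply cos_parity; rewrite <- Rn, <- Rm, <- Rp.
  apply K; rewrite Rminus_diag, Rabs_R0; exact del0.
Qed.

Lemma exp_equation_of_integers n m p : n <> 0%Z -> m <> 0%Z -> p <> 0%Z ->
  (forall z, D z -> hdot (F z) (F z) = RtoC (IZR n ^ 2 * PI ^ 2)) ->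
  (forall z, D z -> hdot (G z) (G z) = RtoC (IZR m ^ 2 * PI ^ 2)) ->
  (forall z, D z -> (2 * hdot (F z) (G z))%C
     = RtoC ((IZR p ^ 2 - IZR n ^ 2 - IZR m ^ 2) * PI ^ 2)) ->
  ((n + m) mod 2 = p mod 2)%Z ->
  forall z, D z -> HCexp (HCadd (hvec (F z)) (hvec (G z)))
     = HCmul (HCexp (hvec (F z))) (HCexp (hvec (G z))).
Proof.
intros n0 m0 p0 En Em Ep par z Dz.
specialize (En z Dz); specialize (Em z Dz); specialize (Ep z Dz).
replace (HCadd (hvec (F z)) (hvec (G z))) with (hvec (HCadd (F z) (G z)))
  by (unfold hvec; hring).
rewrite (HCexp_hvec_pi _ n n0 En), (HCexp_hvec_pi _ m m0 Em), (HCexp_hvec_pi _ p p0).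
- apply cos_parity in par; rewrite par, RtoC_mult; hring.
- rewrite hdot_add, En, Em, Ep, <- !RtoC_plus; f_equal; ring.
Qed.

End Main.

Theorem theorem4p14 (D : C -> Prop) (f g : H -> H)
  (hD : circular_domain D)
  (hreal : exists x : R, Omega D (Hreal x))
  (hf : slice_regular D f) (hg : slice_regular D g) :
  (forall q : H, Omega D q ->
     sexp D (sadd f g) q = smul D (sexp D f) (sexp D g) q)
  <->
  (linearly_dependent D (spartv D f) (spartv D g)
   \/
   exists n m p : Z,
     n <> 0%Z /\ m <> 0%Z /\ p <> 0%Z /\
     (forall q : H, Omega D q ->
        ssym D (spartv D f) q = Hreal (IZR n ^ 2 * PI ^ 2)) /\
     (forall q : H, Omega D q ->
        ssym D (spartv D g) q = Hreal (IZR m ^ 2 * PI ^ 2)) /\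
     (forall q : H, Omega D q ->
        Hscal 2 (sinner D (spartv D f) (spartv D g) q)
        = Hreal ((IZR p ^ 2 - IZR n ^ 2 - IZR m ^ 2) * PI ^ 2)) /\
     ((n + m) mod 2 = p mod 2)%Z).
Proof.
pose proof (proj1 hD) as HD.
destruct hreal as [x0 Hx0], hf as (F & sF & iF & Fh), hg as (G & sG & iG & Gh).
assert (Ff : has_stem D F f) by (split; assumption).
assert (Gg : has_stem D G g) by (split; assumption).
assert (Dx0 : D (x0, 0)).
{ apply Omega_iff in Hx0; [| exact HD].
  replace (0 * 0 + 0 * 0 + 0 * 0) with 0 in Hx0 by ring; now rewrite sqrt_0 in Hx0. }
rewrite (exp_equation_stem D hD F G f g Ff Gg); split.
- intros E; destruct (classic (forall z, D z -> parallel (F z) (G z))) as [P | N].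
  + left; now apply (dependent_of_parallel D hD x0 Dx0 F G).
  + right; destruct (integers_of_not_parallel D hD x0 Dx0 F G f g Ff Gg Fh Gh E N)
      as (n & m & p & n0 & m0 & p0 & En & Em & Ep & par).
    exists n, m, p; repeat (split; [assumption |]).
    split; [now apply (ssym_const_iff D hD F f) |].
    split; [now apply (ssym_const_iff D hD G g) |].
    split; [now apply (sinner_const_iff D hD F G f g) | exact par].
- intros [L | (n & m & p & n0 & m0 & p0 & En & Em & Ep & par)].
  + intros z Dz; apply HCexp_add, parallel_comm.
    now apply (parallel_of_dependent D hD F G f g Ff Gg Fh Gh L).
  + apply (exp_equation_of_integers D F G n m p); try assumption.
    * now apply (ssym_const_iff D hD F f).
    * now apply (ssym_const_iff D hD G g).
    * now apply (sinner_const_iff D hD F G f g).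
Qed.
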